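(* Let $\mu$ be a probability measure concentrated on a finite subset $F$ of $\mathbb{R}^2$ such that $\mu(\{(0,0)\})>0$ and any other point $(x,y)$ with $\mu(\{(x,y)\})>0$ satisfies $x>0$ and $y>0$. Let $\{A_\omega\}$ be the random family of tridiagonal operators on $l^2(\mathbb{Z})$ with zero diagonal generated by $\mu$ as described in the context. Depending on the choice of $\mu$, either $A_\omega$ is self-adjoint with probability $1$ or it is non-self-adjoint with probability $1$. In the latter case, with probability $1$, $A_\omega$ possesses a countable set of eigenvalues whose corresponding eigenvectors (the block eigenvectors described in the context) span a dense linear subspace of $l^2(\mathbb{Z})$, and with probability $1$ this set of eigenvectors is not a basis of $l^2(\mathbb{Z})$.
   Context: The pairs $(A_{n+1,n},A_{n,n+1})$, $n\in\mathbb{Z}$, are independent random vectors in $\mathbb{R}^2$ with common law $\mu$; $A_{m,n}=0$ whenever $m=n$ or $|m-n|>1$; and $A_\omega$ is the resulting bounded operator $(A_\omega f)_m=\sum_n A_{m,n}f_n$ on $l^2(\mathbb{Z})$. Block eigenvectors: almost surely there is a doubly infinite increasing sequence $\{N_r\}_{r\in\mathbb{Z}}$, unbounded above and below, consisting of exactly those $n$ for which $(A_{n+1,n},A_{n,n+1})=(0,0)$. Then $A_\omega$ is the orthogonal direct sum of the finite tridiagonal matrices $C_r=(A_{m,n})_{N_{r-1}<m,n\le N_r}$, each having real eigenvalues of multiplicity one. The eigenvectors of $A_\omega$ referred to in the claim are the family consisting, for each $r$, of one eigenvector of $C_r$ for each eigenvalue of $C_r$, extended by zero to $\mathbb{Z}$.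 ''Basis'' means Schauder basis (for any enumeration of the family). *)

(* Defs.v *)
From HB Require Import structures.
From mathcomp Require Import all_boot all_order all_algebra.
From mathcomp Require Import all_classical all_reals all_analysis.
From mathcomp Require Import complex.

Set Implicit Arguments.
Unset Strict Implicit.
Unset Printing Implicit Defensive.

Import Order.TTheory GRing.Theory Num.Theory.
Import numFieldNormedType.Exports.

Local Open Scope classical_set_scope.
Local Open Scope ring_scope.
Local Open Scope complex_scope.

(* The Hilbert space l^2(Z) of complex sequences is handled as the set [l2] of
   functions int -> R[i] whose norm [l2norm], valued in \bar R, is finite.     *)

Definition l2norm (R : realType) (f : int -> R[i]) : \bar R :=
  sqrte (\esum_(n in [set: int])
           (complex.Re (f n) ^+ 2 + complex.Im (f n) ^+ 2)%:E).

Definition l2 (R : realType) : set (int -> R[i]) :=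
  [set f | (l2norm f < +oo)%E].

(* The sum of an absolutely summable real family; [esum] alone is only
   meaningful for nonnegative families.                                        *)
Definition sumZ (R : realType) (h : int -> R) : R :=
  fine (\esum_(n in [set: int]) (Num.max (h n) 0)%:E)
  - fine (\esum_(n in [set: int]) (Num.max (- h n) 0)%:E).

Definition l2dot (R : realType) (f g : int -> R[i]) : R[i] :=
  sumZ (fun n => complex.Re (f n * (g n)^*))
  +i* sumZ (fun n => complex.Im (f n * (g n)^*)).

Definition bounded_operator (R : realType)
    (T : (int -> R[i]) -> (int -> R[i])) : Prop :=
  exists M : R, forall f, l2 f -> (l2norm (T f) <= M%:E * l2norm f)%E.

Definition self_adjoint (R : realType)
    (T : (int -> R[i]) -> (int -> R[i])) : Prop :=
  bounded_operator T /\
  forall f g, l2 f -> l2 g -> l2dot (T f) g = l2dot f (T g).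

Definition non_self_adjoint (R : realType)
    (T : (int -> R[i]) -> (int -> R[i])) : Prop :=
  bounded_operator T /\ ~ self_adjoint T.

Definition l2_eigenvector (R : realType)
    (T : (int -> R[i]) -> (int -> R[i])) (l : R[i]) (f : int -> R[i]) : Prop :=
  [/\ l2 f, f <> (fun=> 0) & T f = (fun m => l * f m)].

Definition l2_eigenvalue (R : realType)
    (T : (int -> R[i]) -> (int -> R[i])) (l : R[i]) : Prop :=
  exists f, l2_eigenvector T l f.

Definition linear_span (R : realType) (V : set (int -> R[i])) :
    set (int -> R[i]) :=
  [set g | exists k (c : 'I_k -> R[i]) (e : 'I_k -> int -> R[i]),
     (forall i, V (e i)) /\ g = (fun m => \sum_(i < k) c i * e i m)].

Definition l2_dense (R : realType) (V : set (int -> R[i])) : Prop :=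
  V `<=` @l2 R /\
  forall f, l2 f -> forall eps : R, 0 < eps ->
    exists2 g, V g & (l2norm (fun m => f m - g m)%R < eps%:E)%E.

Definition schauder_basis (R : realType) (e : nat -> int -> R[i]) : Prop :=
  (forall k, l2 (e k)) /\
  forall f, l2 f -> exists! a : nat -> R[i],
    l2norm (fun m => f m - \sum_(k < n) a k * e k m) @[n --> \oo] --> (0 : \bar R).

(* A set of vectors is a basis when some enumeration without repetition of it
   is a Schauder basis; [~ l2_basis V] thus rules out every enumeration.       *)
Definition l2_basis (R : realType) (V : set (int -> R[i])) : Prop :=
  exists e : nat -> int -> R[i], set_bij [set: nat] V e /\ schauder_basis e.

(* [x n] stands for the pair (A_{n+1,n}, A_{n,n+1}). *)
Definition entry (R : realType) (x : int -> R * R) (m n : int) : R :=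
  if m == n + 1 then (x n).1 else if n == m + 1 then (x m).2 else 0.

(* The sum below is over the (at most three-element) support in n. *)
Definition tridiag_op (R : realType) (x : int -> R * R) (f : int -> R[i]) :
    int -> R[i] :=
  fun m => \sum_(n \in [set: int]) (entry x m n)%:C * f n.

Definition block_ends (R : realType) (x : int -> R * R) (N : int -> int) :
    Prop :=
  [/\ {homo N : r s / r < s},
      forall k, exists r, k < N r,
      forall k, exists r, N r < k
    & range N = [set n | x n = (0, 0)]].

Definition block_size (N : int -> int) (r : int) : nat :=
  absz (N r - N (r - 1))%R.

(* C_r, its i-th row and column (from 0) being at N_{r-1} + 1 + i. *)
Definition block (R : realType) (x : int -> R * R) (N : int -> int) (r : int) :
    'M[R[i]]_(block_size N r) :=
  \matrix_(i, j) (entry x (N (r - 1) + 1 + i%:Z) (N (r - 1) + 1 + j%:Z))%:C.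

Definition block_extend (R : realType) (N : int -> int) (r : int)
    (u : 'cV[R[i]]_(block_size N r)) : int -> R[i] :=
  fun m => \sum_(i < block_size N r | m == N (r - 1) + 1 + i%:Z) u i 0.

(* [eigenvalue] refers to row vectors, hence the transpose. *)
Definition block_eigenvalues (R : realType) (x : int -> R * R)
    (N : int -> int) (r : int) : set R[i] :=
  [set l | eigenvalue (block x N r)^T l].

Definition block_eigenfamily (R : realType) (x : int -> R * R)
    (N : int -> int) (v : int -> R[i] -> int -> R[i]) : Prop :=
  forall r l, block_eigenvalues x N r l ->
    exists u : 'cV[R[i]]_(block_size N r),
      [/\ u != 0, block x N r *m u = l *: u & v r l = block_extend u].

Definition block_spectrum (R : realType) (x : int -> R * R) (N : int -> int) :
    set R[i] :=
  \bigcup_r block_eigenvalues x N r.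

Definition block_eigenvectors (R : realType) (x : int -> R * R)
    (N : int -> int) (v : int -> R[i] -> int -> R[i]) : set (int -> R[i]) :=
  [set f | exists r l, block_eigenvalues x N r l /\ f = v r l].

Definition mutually_independent (R : realType) (d d' : measure_display)
    (Om : measurableType d) (E : measurableType d') (P : probability Om R)
    (X : int -> {RV P >-> E}) : Prop :=
  forall (J : seq int) (B : int -> set E), uniq J ->
    (forall n, measurable (B n)) ->
    P (\bigcap_(n in [set` J]) (X n @^-1` B n)) =
    (\big[mule/1]_(n <- J) P (X n @^-1` B n))%E.

Definition iid_with_law (R : realType) (d d' : measure_display)
    (Om : measurableType d) (E : measurableType d') (P : probability Om R)
    (mu : probability E R) (X : int -> {RV P >-> E}) : Prop :=
  mutually_independent X /\
  forall n (B : set E), measurable B -> distribution P (X n) B = mu B.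

(* Main.v *)
Require Import Defs.
From HB Require Import structures.
From mathcomp Require Import all_boot all_order all_algebra.
From mathcomp Require Import all_classical all_reals all_analysis.
From mathcomp Require Import spectral complex.
From mathcomp Require Import zify ring lra.

(** Since [mu] has an atom at the origin, almost surely the sites [n] with
    [x n = (0, 0)] cut [int] into finite blocks, and [tridiag_op x] leaves
    invariant the vectors supported in each of them.  The dichotomy is whether
    every atom of [mu] is diagonal: then the operator is almost surely symmetric;
    otherwise an atom [(a, b)] with [a != b] almost surely occurs at some site
    [k], where the unit vectors at [k] and [k + 1] witness that the operator is
    not self-adjoint.

    Density.  A block has positive off-diagonal entries, so conjugating it by a
    positive diagonal matrix makes it real symmetric, hence it is diagonalizable
    ([symmetrizable_diagonalizable], by the spectral theorem).  Its eigenspaces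
    are lines, because an eigenvector is determined by its first entry
    ([hessenberg_eigenvector_unique]); so one eigenvector per eigenvalue spans
    all vectors supported in the block ([block_extend_span]), in particular
    every unit vector.

    No basis.  Almost surely there are, for every [m], blocks with [2 m]
    consecutive entries [(a, b)] ([word_occurs_ae]).  Such a block has size
    [2 m + 1] and kernel vector [(1, 0, - a/b, 0, (a/b)^2, ...)], while the
    functional with coefficients [(1, 0, - b/a, 0, (b/a)^2, ...)] kills the range
    of the operator, hence all eigenvectors with nonzero eigenvalue, and all
    vectors supported in other blocks.  This functional therefore reads off the
    coefficient of the kernel vector in any expansion.
    Put [rho = max (a/b) (b/a) > 1] and place the mass [s ^ m], with
    [1/rho < s < 1], at the end of the [m]-th such block where the kernel vector
    is small: at the other end, the kernel vector term of an expansion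
    of the resulting square summable sequence has modulus
    [(rho s) ^ m / (m + 1)], which stays away from [0]
    ([constant_blocks_not_basis]).  The terms of a convergent expansion tend to
    [0], so the sequence has none.  The explicit sequence takes the place of a
    uniform boundedness argument on the coefficient functionals.

    Almost sure occurrence.  Occurrences of a finite word of atoms in disjoint
    windows are independent with the same positive probability [q], so none
    occurs in [K] windows with probability [(1 - q) ^ K], which tends to [0]. *)

Set Implicit Arguments.
Unset Strict Implicit.
Unset Printing Implicit Defensive.

Import Order.TTheory GRing.Theory Num.Theory.
Import numFieldNormedType.Exports.

Local Open Scope classical_set_scope.
Local Open Scope ring_scope.
Local Open Scope complex_scope.

(** * Square summable sequences and absolutely summable families *)

Section SquareSummable.
Variable R : realType.
Implicit Types (z w : R[i]) (f g : int -> R[i]) (h : int -> R).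

(** The squared modulus as an element of [R]; the norm of [R[i]] takes its
    values in [R[i]]. *)
Definition sqmod z : R := complex.Re z ^+ 2 + complex.Im z ^+ 2.

Lemma sqmod_ge0 z : 0 <= sqmod z.
Proof. by rewrite addr_ge0 ?sqr_ge0. Qed.

Lemma sqmod0 : sqmod 0 = 0.
Proof. by rewrite /sqmod /= expr0n /= addr0. Qed.

Lemma sqmodM z w : sqmod (z * w) = sqmod z * sqmod w.
Proof. by case: z => a b; case: w => c d; rewrite /sqmod /=; ring. Qed.

Lemma sqmod_real (a : R) : sqmod a%:C = a ^+ 2.
Proof. by rewrite /sqmod /= expr0n /= addr0. Qed.

Lemma sqmod_nat n : sqmod n%:R = n%:R ^+ 2.
Proof. by rewrite -(rmorph_nat (real_complex R)) sqmod_real. Qed.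

Lemma sqmodD z w : sqmod (z + w) <= 2 * (sqmod z + sqmod w).
Proof.
case: z => a b; case: w => c d; rewrite /sqmod /=.
have := sqr_ge0 (a - c); have := sqr_ge0 (b - d); nra.
Qed.

Lemma sqmodN z : sqmod (- z) = sqmod z.
Proof. by case: z => a b; rewrite /sqmod /= !sqrrN. Qed.

Definition l2energy f : \bar R := \esum_(n in [set: int]) (sqmod (f n))%:E.

Lemma l2energy_ge0 f : (0 <= l2energy f)%E.
Proof. by apply: esum_ge0 => n _; rewrite lee_fin sqmod_ge0. Qed.

(** A square root is finite exactly when its argument is, so membership in
    [l2] can be tested on the sum of squares. *)
Lemma l2P f : l2 f <-> (l2energy f < +oo)%E.
Proof.
have := l2energy_ge0 f.
rewrite /l2 /= /l2norm -/(l2energy f).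
by case: (l2energy f) => [r| |] //= _; rewrite !ltry.
Qed.

Lemma l2norm_lt f (eps : R) : 0 < eps ->
  (l2norm f < eps%:E)%E = (l2energy f < (eps ^+ 2)%:E)%E.
Proof.
move=> e0; rewrite /l2norm -/(l2energy f).
have -> : eps%:E = sqrte (eps ^+ 2)%:E by rewrite /= sqrtr_sqr gtr0_norm.
by rewrite ltNge lee_sqrt ?l2energy_ge0 // -ltNge.
Qed.

Lemma sqmod_le_energy f m : ((sqmod (f m))%:E <= l2energy f)%E.
Proof.
apply: esum_ge; exists [set m]; last by rewrite fsbig_set1.
by split => //; exact: finite_set1.
Qed.

Lemma l2D f g : l2 f -> l2 g -> l2 (fun m => f m + g m).
Proof.
move=> /l2P lf /l2P lg; apply/l2P.
apply: (@le_lt_trans _ _ (2%:E * (l2energy f + l2energy g))%E); last first.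
  by rewrite lte_mul_pinfty ?lee_fin ?lte_add_pinfty.
have -> : (2%:E * (l2energy f + l2energy g) =
  l2energy f + l2energy g + (l2energy f + l2energy g))%E.
  by rewrite mule_natl mule2n.
rewrite /l2energy -!esumD; try by move=> *; rewrite ?adde_ge0 ?lee_fin ?sqmod_ge0.
apply: le_esum => n _; rewrite -!EFinD lee_fin (le_trans (sqmodD _ _)) //; lra.
Qed.

Lemma esumZ_le (c : R) (a : int -> \bar R) : 0 <= c -> (forall n, 0 <= a n)%E ->
  (\esum_(n in [set: int]) (c%:E * a n) <= c%:E * \esum_(n in [set: int]) a n)%E.
Proof.
move=> c0 a0; apply: ge_ereal_sup => _ [A [finA _] <-].
rewrite -ge0_mule_fsumr // lee_wpmul2l ?lee_fin //.
by apply: ereal_sup_ubound; exists A.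
Qed.

Lemma l2Z (c : R[i]) f : l2 f -> l2 (fun m => c * f m).
Proof.
move=> /l2P lf; apply/l2P; rewrite /l2energy.
under eq_esum do rewrite sqmodM EFinM.
apply: le_lt_trans (esumZ_le (sqmod_ge0 c) _) _.
  by move=> n; rewrite lee_fin sqmod_ge0.
by rewrite lte_mul_pinfty ?lee_fin ?sqmod_ge0.
Qed.

Lemma l20 : l2 (fun=> 0 : R[i]).
Proof.
by apply/l2P; rewrite /l2energy esum1 ?ltry // => n _; rewrite sqmod0.
Qed.

Lemma esum_int_single (a : int -> \bar R) k : (forall n, n != k -> a n = 0%E) ->
  (0 <= a k)%E -> \esum_(n in [set: int]) a n = a k.
Proof.
move=> a0 ak0; rewrite -[RHS](@esum_set1 R int k a) //.
rewrite [RHS]esum_mkcond; apply: eq_esum => n _.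
case: ifPn => // /negP nk; apply: a0; apply/eqP => nE; apply: nk; exact/mem_set.
Qed.

Lemma l2_single f k : (forall n, n != k -> f n = 0) -> l2 f.
Proof.
move=> f0; apply/l2P; rewrite /l2energy (@esum_int_single _ k) ?ltry //.
  by move=> n /f0 ->; rewrite sqmod0.
by rewrite lee_fin sqmod_ge0.
Qed.

Lemma l2_sum (I : Type) (s : seq I) (P : pred I) (F : I -> int -> R[i]) :
  (forall i, P i -> l2 (F i)) -> l2 (fun m => \sum_(i <- s | P i) F i m).
Proof.
move=> lF; elim: s => [|i s IH].
  by rewrite (_ : (fun m => _) = (fun=> 0)); [exact: l20|apply/funext => m; rewrite big_nil].
rewrite (_ : (fun m => _) = (fun m => (if P i then F i m else 0) + \sum_(j <- s | P j) F j m)).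
  apply: l2D => //; case Pi: (P i); [exact: lF|exact: l20].
by apply/funext => m; rewrite big_cons; case: ifP; rewrite ?add0r.
Qed.

Lemma l2_finite_support f (A : set int) : finite_set A ->
  (forall n, ~ A n -> f n = 0) -> l2 f.
Proof.
move=> /finite_seqP[s ->] f0.
rewrite (_ : f = fun m => \sum_(i <- undup s) (if m == i then f m else 0)).
  by apply: l2_sum => i _; apply: (@l2_single _ i) => n /negPf ->.
apply/funext => m; case: (boolP (m \in s)) => ms.
  rewrite (bigD1_seq m) ?mem_undup ?undup_uniq //= eqxx big1 ?addr0 // => i.
  by rewrite eq_sym => /negPf ->.
by rewrite f0 ?big1 //= => [i _|]; [rewrite if_same|exact/negP].
Qed.

Lemma shift_bij (k : int) : set_bij [set: int] [set: int] (fun n => n + k).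
Proof.
split => [n //|n m _ _ /addIr //|n _]; exists (n - k) => //; exact: subrK.
Qed.

Lemma esum_shift (k : int) (a : int -> \bar R) :
  \esum_(n in [set: int]) a (n + k) = \esum_(n in [set: int]) a n.
Proof. by rewrite [RHS](reindex_esum _ _ _ _ (shift_bij k)). Qed.

Definition abs_summable h := summable [set: int] (EFin \o h).

Lemma abs_summable_le h h' : (forall n, `|h n| <= h' n) ->
  (\esum_(n in [set: int]) (h' n)%:E < +oo)%E -> abs_summable h.
Proof.
move=> le fin; apply: le_lt_trans fin; apply: le_esum => n _ /=.
by rewrite lee_fin le.
Qed.

Lemma abs_summable_pos h : abs_summable h ->
  (\esum_(n in [set: int]) (Num.max (h n) 0)%:E < +oo)%E.
Proof.
apply: le_lt_trans; apply: le_esum => n _ /=.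
by rewrite lee_fin ge_max ler_norm normr_ge0.
Qed.

Lemma abs_summable_neg h : abs_summable h ->
  (\esum_(n in [set: int]) (Num.max (- h n) 0)%:E < +oo)%E.
Proof.
apply: le_lt_trans; apply: le_esum => n _ /=.
by rewrite lee_fin ge_max -normrN ler_norm normr_ge0.
Qed.

(** [sumZ] may be computed from any splitting into summable nonnegative parts,
    not just the positive and negative parts; its additivity follows. *)
Lemma sumZ_sub (p q : int -> R) : (forall n, 0 <= p n) -> (forall n, 0 <= q n) ->
  (\esum_(n in [set: int]) (p n)%:E < +oo)%E ->
  (\esum_(n in [set: int]) (q n)%:E < +oo)%E ->
  sumZ (fun n => p n - q n) =
  fine (\esum_(n in [set: int]) (p n)%:E) - fine (\esum_(n in [set: int]) (q n)%:E).
Proof.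
move=> p0 q0 fp fq.
have sp : abs_summable p by apply: (abs_summable_le _ fp) => n; rewrite ger0_norm.
have sq : abs_summable q by apply: (abs_summable_le _ fq) => n; rewrite ger0_norm.
have spq : abs_summable (fun n => p n - q n).
  by have := summableB sp sq; apply: le_lt_trans; apply: le_esum.
have := @esumB R int [set: int] (EFin \o p) (EFin \o q) sp sq.
move=> /(_ (fun i _ => p0 i) (fun i _ => q0 i)) /=.
rewrite (@eq_esum _ _ _ ((EFin \o p) \- (EFin \o q))^\+%E
   (fun n => (Num.max (p n - q n) 0)%:E)); last first.
  by move=> n _; rewrite funeposE /= -EFinB EFin_max.
rewrite (@eq_esum _ _ _ ((EFin \o p) \- (EFin \o q))^\-%E
   (fun n => (Num.max (- (p n - q n)) 0)%:E)); last first.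
  by move=> n _; rewrite funenegE EFin_max.
have fE (a : int -> R) : (forall n, 0 <= a n) ->
  (\esum_(n in [set: int]) (a n)%:E < +oo)%E ->
  (fine (\esum_(n in [set: int]) (a n)%:E))%:E = (\esum_(n in [set: int]) (a n)%:E).
  move=> a0 fa; rewrite fineK // ge0_fin_numE //.
  by apply: esum_ge0 => n _; rewrite lee_fin.
rewrite /sumZ.
rewrite -(fE p p0 fp) -(fE q q0 fq) -(fE _ _ (abs_summable_pos spq)); last first.
  by move=> n; rewrite le_max lexx orbT.
rewrite -(fE _ _ (abs_summable_neg spq)); last first.
  by move=> n; rewrite le_max lexx orbT.
by rewrite -!EFinB => -[].
Qed.

Lemma sumZD h1 h2 : abs_summable h1 -> abs_summable h2 ->
  sumZ (fun n => h1 n + h2 n) = sumZ h1 + sumZ h2.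
Proof.
move=> s1 s2.
have m0 (a : R) : 0 <= Num.max a 0 by rewrite le_max lexx orbT.
have maxE (a : R) : a = Num.max a 0 - Num.max (- a) 0.
  by rewrite /Num.max; case: ifP; case: ifP; lra.
rewrite (_ : (fun n => _) = fun n => (Num.max (h1 n) 0 + Num.max (h2 n) 0) -
   (Num.max (- h1 n) 0 + Num.max (- h2 n) 0)); last first.
  by apply/funext => n; rewrite {1}(maxE (h1 n)) {1}(maxE (h2 n)); lra.
have fE (h : int -> R) : (\esum_(n in [set: int]) (Num.max (h n) 0)%:E < +oo)%E ->
   (\esum_(n in [set: int]) (Num.max (h n) 0)%:E) \is a fin_num.
   by move=> fa; rewrite ge0_fin_numE // esum_ge0 // => n _; rewrite lee_fin.
have p1 := abs_summable_pos s1. have p2 := abs_summable_pos s2.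
have n1 := abs_summable_neg s1. have n2 := abs_summable_neg s2.
have splitE (a b : int -> R) :
  \esum_(n in [set: int]) (Num.max (a n) 0 + Num.max (b n) 0)%:E =
  (\esum_(n in [set: int]) (Num.max (a n) 0)%:E +
   \esum_(n in [set: int]) (Num.max (b n) 0)%:E)%E.
  by rewrite -esumD // => n _; rewrite lee_fin.
rewrite sumZ_sub ?splitE ?lte_add_pinfty //; try by move=> n; rewrite addr_ge0.
rewrite !fineD ?fE // /sumZ; try exact: (fE (fun n => - _ n)).
by lra.
Qed.

Lemma sumZ_shift h (k : int) : sumZ (fun n => h (n + k)) = sumZ h.
Proof.
rewrite /sumZ (esum_shift k (fun n => (Num.max (h n) 0)%:E)).
by rewrite (esum_shift k (fun n => (Num.max (- h n) 0)%:E)).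
Qed.

Lemma sumZ_single h k : (forall n, n != k -> h n = 0) -> sumZ h = h k.
Proof.
move=> h0; rewrite /sumZ !(@esum_int_single _ k) /=;
  try by [move=> n /h0 ->; rewrite ?oppr0 maxxx | rewrite lee_fin le_max lexx orbT].
by rewrite /Num.max; case: ifP; case: ifP; lra.
Qed.

End SquareSummable.

(** * The tridiagonal operator *)

Section TridiagonalOperator.
Variable R : realType.
Implicit Types (x : int -> R * R) (f g : int -> R[i]).

Lemma tridiag_opE x f m : tridiag_op x f m =
  (x (m - 1)).1%:C * f (m - 1) + (x m).2%:C * f (m + 1).
Proof.
rewrite /tridiag_op (@fsbigE _ _ _ _ _ [:: m - 1; m + 1]) //=.
- rewrite !big_cons big_nil !mem_setT addr0 /entry subrK eqxx.
  have -> : (m == m + 1 + 1) = false by lia.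
  by rewrite eqxx.
- by rewrite inE andbT; lia.
- move=> n _; rewrite !inE negb_or => /andP[n1 n2]; rewrite /entry.
  have -> : (m == n + 1) = false by lia.
  have -> : (n == m + 1) = false by lia.
  by rewrite mul0r.
Qed.

Lemma tridiag_bounded x (M : R) : (forall n, `|(x n).1| <= M) ->
  (forall n, `|(x n).2| <= M) -> bounded_operator (tridiag_op x).
Proof.
move=> M1 M2; have M0 : 0 <= M := le_trans (normr_ge0 _) (M1 0).
exists (2 * M) => f lf.
have en : (l2energy (tridiag_op x f) <= ((2 * M) ^+ 2)%:E * l2energy f)%E.
  have -> : (((2 * M) ^+ 2)%:E * l2energy f = (2 * M ^+ 2)%:E *
     \esum_(n in [set: int]) ((sqmod (f (n - 1)))%:E + (sqmod (f (n + 1)))%:E))%E.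
    rewrite esumD; try by move=> n _; rewrite lee_fin sqmod_ge0.
    rewrite (esum_shift (-1) (fun n => (sqmod (f n))%:E)).
    rewrite (esum_shift 1 (fun n => (sqmod (f n))%:E)) -/(l2energy f).
    by rewrite -mule2n -mule_natl muleA -EFinM; congr (_%:E * _)%E; ring.
  apply: le_trans (esumZ_le _ _); first apply: le_esum => n _.
  - rewrite -EFinD -EFinM lee_fin tridiag_opE (le_trans (sqmodD _ _)) //.
    rewrite !sqmodM !sqmod_real.
    have h a : `|a| <= M -> a ^+ 2 <= M ^+ 2.
      by move=> aM; rewrite -[leLHS]real_normK ?num_real // ler_sqr ?nnegrE.
    have := h _ (M1 (n - 1)); have := h _ (M2 n).
    have := sqmod_ge0 (f (n - 1)); have := sqmod_ge0 (f (n + 1)); nra.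
  - by rewrite mulr_ge0 ?sqr_ge0.
  - by move=> n; rewrite adde_ge0 ?lee_fin ?sqmod_ge0.
have -> : (2 * M)%:E = sqrte ((2 * M) ^+ 2)%:E.
  by rewrite /= sqrtr_sqr ger0_norm // mulr_ge0.
rewrite /l2norm -!/(l2energy _) -sqrteM ?lee_fin ?sqr_ge0 // lee_sqrt //.
by rewrite mule_ge0 ?lee_fin ?sqr_ge0 ?l2energy_ge0.
Qed.

Lemma conjc_comb (a b : R) (z w : R[i]) :
  ((a%:C * z + b%:C * w)^* = a%:C * z^* + b%:C * w^*)%R.
Proof.
rewrite rmorphD !rmorphM /=; congr (_ * _ + _ * _); exact: conjc_real.
Qed.

(** Here [p] is the real or the imaginary part. Both sides expand into the
    same two families, indexed by edges, up to a shift of the index; the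
    bounds make the families summable so that [sumZ] may be split and shifted. *)
Lemma tridiag_part_symmetric x (p : R[i] -> R) (M : R) f g :
  (forall n, `|(x n).1| <= M) -> (forall n, (x n).1 = (x n).2) ->
  (forall (a b : R) z w, p (a%:C * z + b%:C * w) = a * p z + b * p w) ->
  (forall z w, `|p (z * w^*)| <= sqmod z + sqmod w) ->
  l2 f -> l2 g ->
  sumZ (fun n => p (tridiag_op x f n * (g n)^*)) =
  sumZ (fun n => p (f n * (tridiag_op x g n)^*)).
Proof.
move=> M1 xs pD ple lf lg.
have M0 : 0 <= M := le_trans (normr_ge0 _) (M1 0).
pose al n := (x n).1 * p (f n * (g (n + 1))^*).
pose be n := (x n).1 * p (f (n + 1) * (g n)^*).
have summ (u v : int -> R[i]) : l2 u -> l2 v ->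
  (\esum_(n in [set: int]) (M * (sqmod (u n) + sqmod (v n)))%:E < +oo)%E.
  move=> /l2P lu /l2P lv.
  under eq_esum do rewrite EFinM.
  apply: le_lt_trans (esumZ_le M0 _) _.
    by move=> n; rewrite lee_fin addr_ge0 ?sqmod_ge0.
  under eq_esum do rewrite EFinD.
  rewrite esumD; try by move=> n _; rewrite lee_fin sqmod_ge0.
  by rewrite lte_mul_pinfty ?lee_fin // lte_add_pinfty.
have shl2 (u : int -> R[i]) k : l2 u -> l2 (fun n => u (n + k)).
  by move=> /l2P lu; apply/l2P; rewrite /l2energy (esum_shift k (fun n => (sqmod (u n))%:E)).
have bnd a z w : `|a| <= M -> `|a * p (z * w^*)| <= M * (sqmod z + sqmod w).
  by move=> aM; rewrite normrM ler_pM.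
have sal : abs_summable al.
  apply: abs_summable_le (summ _ _ lf (shl2 _ 1 lg)) => n; exact: bnd.
have sbe : abs_summable be.
  apply: abs_summable_le (summ _ _ (shl2 _ 1 lf) lg) => n; exact: bnd.
have shs (h : int -> R) k : abs_summable h -> abs_summable (fun n => h (n + k)).
  by rewrite /abs_summable /summable /= (esum_shift k (fun n => (`|h n|)%:E)).
transitivity (sumZ (fun n => al (n - 1) + be n)).
  congr sumZ; apply/funext => n; rewrite tridiag_opE -xs mulrDl -!mulrA pD.
  by rewrite /al /be subrK.
transitivity (sumZ (fun n => be (n - 1) + al n)); last first.
  congr sumZ; apply/funext => n; rewrite tridiag_opE -xs conjc_comb.
  rewrite mulrDr (mulrCA (f n)) (mulrCA (f n) (x n).1%:C) pD.
  by rewrite /al /be subrK.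
rewrite !sumZD //; try exact: shs.
by rewrite !sumZ_shift addrC.
Qed.

Lemma ReIm_le (z w : R[i]) : `|complex.Re (z * w^*)| <= sqmod z + sqmod w /\
  `|complex.Im (z * w^*)| <= sqmod z + sqmod w.
Proof.
case: z => a b; case: w => c d; rewrite /sqmod /= !ler_norml.
have := sqr_ge0 (a - c); have := sqr_ge0 (a + c).
have := sqr_ge0 (a - d); have := sqr_ge0 (a + d).
have := sqr_ge0 (b - c); have := sqr_ge0 (b + c).
have := sqr_ge0 (b - d); have := sqr_ge0 (b + d).
by split; apply/andP; split; nra.
Qed.

Lemma tridiag_self_adjoint x (M : R) : (forall n, `|(x n).1| <= M) ->
  (forall n, (x n).1 = (x n).2) -> self_adjoint (tridiag_op x).
Proof.
move=> M1 xs; split; first by apply: (tridiag_bounded M1) => n; rewrite -xs.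
move=> f g lf lg; rewrite /l2dot; congr (_ +i* _);
  apply: tridiag_part_symmetric M1 xs _ _ lf lg.
- by move=> a b [u v] [u' v'] /=; ring.
- by move=> z w; have [] := ReIm_le z w.
- by move=> a b [u v] [u' v'] /=; ring.
- by move=> z w; have [] := ReIm_le z w.
Qed.

Lemma tridiag_non_self_adjoint x (M : R) k : (forall n, `|(x n).1| <= M) ->
  (forall n, `|(x n).2| <= M) -> (x k).1 != (x k).2 ->
  non_self_adjoint (tridiag_op x).
Proof.
move=> M1 M2 xk; split; first exact: tridiag_bounded M1 M2.
move=> [_ sa]; move/negP: xk; apply.
pose e j : int -> R[i] := fun n => (n == j)%:R.
have le j : l2 (e j) by apply: (@l2_single _ _ j) => n /negPf; rewrite /e => ->.
have := congr1 (@complex.Re R) (sa _ _ (le k) (le (k + 1))).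
rewrite /l2dot [LHS]/= [RHS]/= (@sumZ_single _ _ (k + 1)); last first.
  by move=> n /negPf; rewrite {2}/e => ->; rewrite rmorph0 mulr0.
rewrite (@sumZ_single _ _ k); last first.
  by move=> n /negPf; rewrite {1}/e => ->; rewrite mul0r.
rewrite !tridiag_opE /e addrK !eqxx.
have -> : (k + 1 + 1 == k) = false by lia.
have -> : (k - 1 == k + 1) = false by lia.
rewrite !mulr0 addr0 add0r conjC1 mul1r !mulr1.
have -> : ((x k).2%:C^*)%R = (x k).2%:C := conjc_real _.
by move=> /= ->.
Qed.

End TridiagonalOperator.

(** * Tridiagonal matrices *)

Section JacobiMatrices.

(** Row [k] of the eigenvalue equation determines entry [k + 1] from the
    previous ones, as its coefficient there is nonzero. *)
Lemma hessenberg_eigenvector_eq0 (K : fieldType) n (C : 'M[K]_n) (u : 'cV[K]_n) l :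
  (forall i j : 'I_n, (i.+1 < j)%N -> C i j = 0) ->
  (forall i j : 'I_n, i.+1 = j -> C i j != 0) ->
  C *m u = l *: u -> (forall i : 'I_n, i = 0%N :> nat -> u i 0 = 0) -> u = 0.
Proof.
move=> C0 C1 Cu u0.
have main k : forall i : 'I_n, (i <= k)%N -> u i 0 = 0.
  elim: k => [|k IH] i ik; first by apply: u0; apply/eqP; rewrite -leqn0.
  move: ik; rewrite leq_eqVlt ltnS => /predU1P[ik|]; last exact: IH.
  have kn : (k < n)%N by have := ltn_ord i; lia.
  have := congr1 (fun v : 'cV_n => v (Ordinal kn) 0) Cu.
  rewrite !mxE (IH (Ordinal kn)) // mulr0 (bigD1 i) //= big1 ?addr0 => [|j ji].
    by move/eqP; rewrite mulf_eq0 (negPf (C1 _ _ _)) //= => /eqP.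
  have [jk|kj] := leqP j k; first by rewrite IH // mulr0.
  rewrite C0 ?mul0r //=; have : (j : nat) <> i by move=> /val_inj jiE; rewrite jiE eqxx in ji.
  by lia.
by apply/matrixP => i j; rewrite ord1 mxE; apply: (main i).
Qed.

(** The difference of two eigenvectors, scaled to agree at the first entry,
    vanishes. *)
Lemma hessenberg_eigenvector_unique (K : fieldType) n (C : 'M[K]_n)
    (u v : 'cV[K]_n) l :
  (forall i j : 'I_n, (i.+1 < j)%N -> C i j = 0) ->
  (forall i j : 'I_n, i.+1 = j -> C i j != 0) ->
  C *m u = l *: u -> C *m v = l *: v -> u != 0 -> exists c, v = c *: u.
Proof.
case: n C u v => [|n] C u v C0 C1 Cu Cv u0.
  by exists 0; apply/matrixP => -[].
have u00 : u 0 0 != 0.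
  apply: contra u0 => /eqP u0; apply/eqP.
  apply: hessenberg_eigenvector_eq0 C0 C1 Cu _ => i i0.
  by rewrite (_ : i = 0) //; apply: val_inj.
exists (v 0 0 / u 0 0); apply/eqP; rewrite -subr_eq0; apply/eqP.
apply: (hessenberg_eigenvector_eq0 C0 C1 (l := l)) => [|i i0].
  by rewrite mulmxBr -scalemxAr Cu Cv scalerBr !scalerA mulrC.
rewrite (_ : i = 0); last exact: val_inj.
by rewrite !mxE divfK // subrr.
Qed.

(** With [s i] the square root of [w i], the matrix with entries [s i * C i j
    / s j] is real symmetric, hence unitarily diagonalizable, and [C] is
    similar to it. The columns of [Q] are eigenvectors. *)
Lemma symmetrizable_diagonalizable (R : rcfType) n (C : 'M[R]_n) (w : 'I_n -> R) :
  (forall i, 0 < w i) -> (forall i j, w i * C i j = w j * C j i) ->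
  exists (Q : 'M[R[i]]_n) (d : 'rV[R[i]]_n),
    Q \in unitmx /\ map_mx (real_complex R) C *m Q = Q *m diag_mx d.
Proof.
move=> w0 wC; pose s i := Num.sqrt (w i).
have s0 i : s i != 0 by rewrite lt0r_neq0 // sqrtr_gt0.
pose S : 'M[R[i]]_n := \matrix_(i, j) (s i * C i j / s j)%:C.
have Sh : S \is hermsymmx.
  apply: realsym_hermsym.
    apply/is_hermitianmxP; rewrite expr0 scale1r map_mx_id //.
    apply/matrixP => i j; rewrite !mxE; congr (_%:C).
    have sw k : s k * s k = w k by rewrite -expr2 sqr_sqrtr // ltW.
    apply/eqP; rewrite eqr_div //; apply/eqP.
    transitivity (w i * C i j); first by rewrite -sw; ring.
    by rewrite wC -sw; ring.
  by apply/mxOverP => i j; rewrite mxE; apply/complex_realP; eexists.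
pose D : 'M[R[i]]_n := diag_mx (\row_i (s i)%:C).
pose D' : 'M[R[i]]_n := diag_mx (\row_i (s i)^-1%:C).
have DD' : D *m D' = 1%:M.
  apply/matrixP => i j; rewrite /D mul_diag_mx !mxE.
  case: eqP => [->|_]; last by rewrite mulr0n mulr0.
  by rewrite !mulr1n -rmorphM mulfV.
have D'D : D' *m D = 1%:M by exact: mulmx1C.
have SE : S = D *m map_mx (real_complex R) C *m D'.
  by apply/matrixP => i j; rewrite /D /D' mul_mx_diag mul_diag_mx !mxE -!rmorphM.
have [P Pu SP] : exists2 P : 'M[R[i]]_n, P \in unitmx &
   exists d, S = invmx P *m diag_mx d *m P.
  have /orthomx_spectralP SN := hermitian_normalmx Sh.
  exists (spectralmx S); first exact: spectral_unit.
  by exists (spectral_diag S).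
have [d SPd] := SP.
have D'u : D' \in unitmx by have [] := mulmx1_unit D'D.
exists (D' *m invmx P), d; split; first by rewrite unitmx_mul D'u unitmx_inv.
rewrite -[map_mx _ _]mul1mx -D'D -!mulmxA; congr (_ *m _).
by rewrite !mulmxA -SE SPd -!mulmxA mulmxV // mulmx1.
Qed.

End JacobiMatrices.

(** * Unbounded sets of integers *)

Section IntegerSequences.

Lemma increasing_bracket (N : int -> int) : {homo N : r s / r < s} ->
  (forall k, exists r, k < N r) -> (forall k, exists r, N r < k) ->
  forall m, exists r, N (r - 1) < m <= N r.
Proof.
move=> Nlt Nup Nlow m.
have Nle r s : r <= s -> N r <= N s.
  by rewrite le_eqVlt => /predU1P[->//|/Nlt /ltW].
have [r1 m1] := Nup m; have [r2 m2] := Nlow m.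
have r21 : r2 < r1 by case: (ltP r2 r1) => // /Nle; lia.
have [k kE] : exists k : nat, r1 = r2 + k%:Z by exists (absz (r1 - r2)%R); lia.
rewrite {}kE {r21} in m1; elim: k => [|k IH] in r2 m1 m2 *; first by rewrite addr0 in m1; lia.
have [mr|mr] := leP m (N (r2 + 1)).
  by exists (r2 + 1); rewrite addrK m2.
by apply: (IH (r2 + 1)) => //; rewrite (_ : r2 + 1 + k = r2 + k.+1) //; lia.
Qed.

Lemma next_element (Z : set int) k : (exists2 n, k < n & Z n) ->
  exists n, [/\ k < n, Z n & forall m, k < m -> Z m -> n <= m].
Proof.
move=> [n kn Zn].
have ex : exists i : nat, `[< Z (k + 1 + i%:Z) >].
  by exists (absz (n - k - 1)%R); apply/asboolP; rewrite (_ : _ + _ = n) //; lia.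
case: (ex_minnP ex) => i /asboolP Zi imin.
exists (k + 1 + i%:Z); split => // [|m km Zm]; first by lia.
have := imin (absz (m - k - 1)%R); rewrite (_ : k + 1 + _ = m); last by lia.
by move=> /(_ (asboolT Zm)); lia.
Qed.

(** Starting from an element of [Z], iterate the map to the next larger
    element for nonnegative indices, and to the next smaller one for negative
    indices. *)
Lemma unbounded_enumeration (Z : set int) :
  (forall k, exists2 n, k < n & Z n) -> (forall k, exists2 n, n < k & Z n) ->
  exists N : int -> int,
    [/\ {homo N : r s / r < s}, forall k, exists r, k < N r,
        forall k, exists r, N r < k & range N = Z].
Proof.
move=> Zup Zlow.
pose nx k := projT1 (cid (next_element (Zup k))).
have nxP k : [/\ k < nx k, Z (nx k) & forall m, k < m -> Z m -> nx k <= m].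
  exact: projT2 (cid (next_element (Zup k))).
have pvex (k : int) : exists n, [/\ n < k, Z n & forall m, m < k -> Z m -> m <= n].
  have [|n [kn Zn nmin]] := @next_element [set n | Z (- n)] (- k).
    by have [n nk Zn] := Zlow k; exists (- n); rewrite ?ltrN2 //= opprK.
  exists (- n); split => // [|m mk Zm]; first by lia.
  by have := nmin (- m); rewrite /= opprK ltrN2 => /(_ mk Zm); lia.
pose pv k := projT1 (cid (pvex k)).
have pvP k : [/\ pv k < k, Z (pv k) & forall m, m < k -> Z m -> m <= pv k].
  exact: projT2 (cid (pvex k)).
have nxpv k : Z k -> nx (pv k) = k.
  move=> Zk; have [k1 _ k2] := pvP k; have [k3 Zn k4] := nxP (pv k).
  have := k4 k k1 Zk; rewrite le_eqVlt => /predU1P[//|lt].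
  by have := k2 _ lt Zn; lia.
have [z0 _ Z0] := Zup 0.
pose N (r : int) : int := match r with Posz n => iter n nx z0 | Negz n => iter n.+1 pv z0 end.
have ZN r : Z (N r).
  by case: r => [[//|n]|n] /=; [have [] := nxP (iter n nx z0)|have [] := pvP (iter n pv z0)].
have NS r : N (r + 1) = nx (N r).
  case: r => [n|[|n]]; first by rewrite (_ : n%:Z + 1 = n.+1) //; lia.
    by rewrite (_ : Negz 0 + 1 = 0) //= nxpv.
  rewrite (_ : Negz n.+1 + 1 = Negz n) //; last by lia.
  by rewrite [in RHS]/= nxpv //; exact: (ZN (Negz n)).
have Nk r (k : nat) : N r + k%:Z <= N (r + k%:Z).
  elim: k => [|k IH]; first by rewrite !addr0.
  rewrite (_ : r + k.+1 = r + k%:Z + 1); last by lia.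
  by rewrite NS; have [] := nxP (N (r + k%:Z)); lia.
have Nlt : {homo N : r s / r < s}.
  move=> r s rs; have := Nk r (absz (s - r)%R).
  by rewrite (_ : r + _ = s); lia.
have Nup (k : int) : exists r, k < N r.
  by exists (absz (k - z0 + 1)%R)%:Z; have := Nk 0 (absz (k - z0 + 1)%R); rewrite add0r /=; lia.
have Nlow (k : int) : exists r, N r < k.
  pose n := absz (z0 - k + 1)%R; exists (- n%:Z); have := Nk (- n%:Z) n.
  by rewrite addNr /n /=; lia.
exists N; split => //; apply/seteqP; split => [_ [r _ <-]//|n Zn].
have [r /andP[rn nr]] := increasing_bracket Nlt Nup Nlow n.
exists r => //; apply/eqP; rewrite eq_le nr andbT.
by rewrite -[r in N r](subrK 1) NS; have [_ _] := nxP (N (r - 1)); apply.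
Qed.

End IntegerSequences.

(** * The block decomposition *)

Section Blocks.
Variables (R : realType) (x : int -> R * R) (N : int -> int).
Hypothesis xN : block_ends x N.

Definition in_block (r m : int) : bool := N (r - 1) < m <= N r.

Definition block_site (r : int) (i : nat) : int := N (r - 1) + 1 + i%:Z.

Definition block_sites (r : int) : seq int :=
  [seq block_site r (i : 'I__) | i : 'I_(block_size N r)].

Lemma block_ends_lt r s : r < s -> N r < N s.
Proof. by case: xN => h _ _ _; exact: h. Qed.

Lemma block_ends_le r s : r <= s -> N r <= N s.
Proof. by rewrite le_eqVlt => /predU1P[->//|/block_ends_lt /ltW]. Qed.

Lemma block_sizeE r : (block_size N r)%:Z = N r - N (r - 1).
Proof. by have := @block_ends_lt (r - 1) r ltac:(lia); rewrite /block_size; lia. Qed.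

Lemma block_site_in r (i : 'I_(block_size N r)) : in_block r (block_site r i).
Proof.
by have := block_sizeE r; have := ltn_ord i; rewrite /in_block /block_site; lia.
Qed.

Lemma in_blockP r m : in_block r m ->
  exists i : 'I_(block_size N r), m = block_site r i.
Proof.
rewrite /in_block => mr; have sE := block_sizeE r.
have h : (absz (m - N (r - 1) - 1)%R < block_size N r)%N by lia.
by exists (Ordinal h); rewrite /block_site /=; lia.
Qed.

Lemma in_block_exists m : exists r, in_block r m.
Proof.
by case: xN => lt up low _; exact: increasing_bracket lt up low m.
Qed.

Lemma in_block_inj r s m : in_block r m -> in_block s m -> r = s.
Proof.
rewrite /in_block => mr ms; have [rs|sr|//] := ltgtP r s.
  by have := @block_ends_le r (s - 1) ltac:(lia); lia.
by have := @block_ends_le s (r - 1) ltac:(lia); lia.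
Qed.

Lemma block_ends_zero r : x (N r) = (0, 0).
Proof. by case: xN => _ _ _ /seteqP[+ _] => /(_ (N r)); apply; exists r. Qed.

Lemma block_interior_neq0 r m : in_block r m -> m != N r -> x m <> (0, 0).
Proof.
rewrite /in_block => mr mN xm; have [s _ sm] : range N m by case: xN => _ _ _ ->.
case: (leP s (r - 1)) => [/block_ends_le|rs]; first by lia.
by have := @block_ends_le r s ltac:(lia); lia.
Qed.

Lemma block_extend_site r (u : 'cV[R[i]]_(block_size N r)) (i : 'I_(block_size N r)) :
  block_extend u (block_site r i) = u i 0.
Proof.
rewrite /block_extend (big_pred1 i) // => j; rewrite /block_site.
by apply/eqP/eqP => [|->//]; move=> ji; apply: val_inj => /=; lia.
Qed.

Lemma block_extend_out r (u : 'cV[R[i]]_(block_size N r)) m : ~~ in_block r m ->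
  block_extend u m = 0.
Proof.
move=> mr; rewrite /block_extend big1 // => i /eqP mE.
by rewrite mE -/(block_site r i) block_site_in in mr.
Qed.

Lemma block_extendP r (u : 'cV[R[i]]_(block_size N r)) (f : int -> R[i]) :
  (forall i : 'I_(block_size N r), f (block_site r i) = u i 0) ->
  (forall m, ~~ in_block r m -> f m = 0) -> block_extend u = f.
Proof.
move=> f1 f2; apply/funext => m; have [mr|mr] := boolP (in_block r m).
  by have [i ->] := in_blockP mr; rewrite block_extend_site f1.
by rewrite block_extend_out // f2.
Qed.

Lemma block_extend0 r : block_extend (0 : 'cV[R[i]]_(block_size N r)) = fun=> 0.
Proof. by apply: block_extendP => // i; rewrite mxE. Qed.

Lemma block_extendD r (u v : 'cV[R[i]]_(block_size N r)) :
  block_extend (u + v) = fun m => block_extend u m + block_extend v m.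
Proof.
apply: block_extendP => [i|m mr]; first by rewrite !block_extend_site mxE.
by rewrite !block_extend_out // addr0.
Qed.

Lemma block_extendZ r (c : R[i]) (u : 'cV[R[i]]_(block_size N r)) :
  block_extend (c *: u) = fun m => c * block_extend u m.
Proof.
apply: block_extendP => [i|m mr]; first by rewrite !block_extend_site mxE.
by rewrite !block_extend_out // mulr0.
Qed.

Lemma block_extend_neq0 r (u : 'cV[R[i]]_(block_size N r)) : u != 0 ->
  block_extend u <> (fun=> 0).
Proof.
move=> /eqP u0 E; apply: u0; apply/matrixP => i j.
by rewrite ord1 mxE -block_extend_site E.
Qed.

Lemma block_extend_l2 r (u : 'cV[R[i]]_(block_size N r)) : l2 (block_extend u).
Proof.
apply: (@l2_finite_support _ _ [set` (block_sites r)]).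
  exact: finite_seq.
move=> n nr; rewrite block_extend_out //; apply/negP => /in_blockP[j nE].
by apply: nr; rewrite /= nE; apply/map_f; rewrite mem_enum.
Qed.

(** Both edges joining the block to its neighbours carry the entry pair [(0,
    0)]. *)
Lemma tridiag_block_extend r (u : 'cV[R[i]]_(block_size N r)) :
  tridiag_op x (block_extend u) = block_extend (block x N r *m u).
Proof.
apply/esym/block_extendP => [i|m mr]; last first.
  rewrite /tridiag_op fsbig1 // => n _.
  have [nr|nr] := boolP (in_block r n); last by rewrite block_extend_out ?mulr0.
  rewrite /entry; case: eqP => [mE|_].
    have -> : n = N r by move: nr mr; rewrite /in_block; lia.
    by rewrite block_ends_zero mul0r.
  case: eqP => [nE|_]; last by rewrite mul0r.
  have -> : m = N (r - 1) by move: nr mr; rewrite /in_block; lia.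
  by rewrite block_ends_zero mul0r.
rewrite /tridiag_op (@fsbigE _ _ _ _ _ (block_sites r)) //=.
- rewrite /block_sites big_map big_enum_cond /= mxE; apply: eq_big => [j|j _].
    by rewrite mem_setT.
  by rewrite block_extend_site mxE.
- rewrite map_inj_uniq ?enum_uniq // => j k; rewrite /block_site => jk.
  by apply: val_inj => /=; lia.
- move=> n _ nr; rewrite block_extend_out ?mulr0 //; apply/negP => /in_blockP[j nE].
  by move/negP: nr; apply; rewrite nE; apply/map_f; rewrite mem_enum.
Qed.

End Blocks.

(** * Block eigenvectors span a dense subspace *)

Section LinearSpan.
Variables (R : realType) (V : set (int -> R[i])).

Lemma linear_span_sub : V `<=` linear_span V.
Proof.
move=> f Vf; exists 1%N, (fun=> 1), (fun=> f); split => //.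
by apply/funext => m; rewrite big_ord1 mul1r.
Qed.

Lemma linear_span0 : linear_span V (fun=> 0).
Proof.
exists 0%N, (fun=> 0), (fun _ _ => 0); split => [[]//|].
by apply/funext => m; rewrite big_ord0.
Qed.

Lemma linear_spanD f g : linear_span V f -> linear_span V g ->
  linear_span V (fun m => f m + g m).
Proof.
move=> [k [c [e [Ve ->]]]] [k' [c' [e' [Ve' ->]]]].
pose pick T (a : 'I_k -> T) (a' : 'I_k' -> T) (i : 'I_(k + k')) :=
  match fintype.split i with inl j => a j | inr j => a' j end.
exists (k + k')%N, (pick _ c c'), (pick _ e e'); split.
  by move=> i; rewrite /pick; case: (fintype.split i).
apply/funext => m; rewrite big_split_ord /=; congr (_ + _); apply: eq_bigr => i _.
  by rewrite /pick (unsplitK (inl i)).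
by rewrite /pick (unsplitK (inr i)).
Qed.

Lemma linear_spanZ a f : linear_span V f -> linear_span V (fun m => a * f m).
Proof.
move=> [k [c [e [Ve ->]]]]; exists k, (fun i => a * c i), e; split => //.
by apply/funext => m; rewrite mulr_sumr; apply: eq_bigr => i _; rewrite mulrA.
Qed.

Lemma linear_span_sum (I : Type) (s : seq I) (F : I -> int -> R[i]) :
  (forall i, linear_span V (F i)) ->
  linear_span V (fun m => \sum_(i <- s) F i m).
Proof.
move=> VF; elim: s => [|i s IH].
  by rewrite (_ : (fun m => _) = fun=> 0); [exact: linear_span0|apply/funext => m; rewrite big_nil].
rewrite (_ : (fun m => _) = fun m => F i m + \sum_(j <- s) F j m).
  exact: linear_spanD.
by apply/funext => m; rewrite big_cons.
Qed.

Lemma linear_span_l2 : V `<=` @l2 R -> linear_span V `<=` @l2 R.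
Proof.
move=> Vl2 _ [k [c [e [Ve ->]]]].
by apply: l2_sum => i _; apply: l2Z; exact: Vl2.
Qed.

(** A finite set carrying all but [eps ^+ 2] of the energy gives a truncation
    at distance less than [eps]. *)
Lemma linear_span_dense : V `<=` @l2 R ->
  (forall k : int, linear_span V (fun m => (m == k)%:R)) -> l2_dense (linear_span V).
Proof.
move=> Vl2 Vdelta; split; first exact: linear_span_l2.
move=> f /l2P lf eps e0.
have e20 : 0 < eps ^+ 2 by rewrite exprn_gt0.
have fin : l2energy f \is a fin_num by rewrite ge0_fin_numE ?l2energy_ge0.
have [_ [A [finA _] <-] Af] := ub_ereal_sup_adherent e20 fin.
have /finite_seqP[s sA] := finA.
pose g m := if m \in s then f m else 0.
exists g.
  rewrite (_ : g = fun m => \sum_(i <- undup s) f i * (m == i)%:R).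
    by apply: linear_span_sum => i; apply: linear_spanZ.
  apply/funext => m; rewrite /g; case: ifPn => ms.
    rewrite (bigD1_seq m) ?mem_undup ?undup_uniq //= eqxx mulr1 big1 ?addr0 // => i.
    by rewrite eq_sym => /negPf ->; rewrite mulr0.
  rewrite big1_seq // => i /andP[_]; rewrite mem_undup => si.
  case: eqP => [mi|]; last by rewrite mulr0.
  by rewrite mi si in ms.
rewrite l2norm_lt //.
have := Af; rewrite -[X in (X - _)%E]/(l2energy f).
have -> : l2energy f = (\sum_(i \in A) (sqmod (f i))%:E + l2energy (fun m => (f m - g m)%R))%E.
  rewrite {1}/l2energy (esumID A) => [|i _]; last by rewrite lee_fin sqmod_ge0.
  rewrite setTI esum_fset //; last by move=> i _; rewrite lee_fin sqmod_ge0.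
  congr (_ + _)%E; rewrite setTI esum_mkcond; apply: eq_esum => i _.
  rewrite /g sA; case: ifPn => [|/negP].
    by rewrite inE /= => /negP/negPf ->; rewrite subr0.
  rewrite inE /= => /contrapT ->; by rewrite subrr sqmod0.
have -> : (\sum_(i \in A) (sqmod (f i))%:E)%E = (\sum_(i \in A) (sqmod (f i)))%R%:E.
  by rewrite fsumEFin.
have : (l2energy (fun m => (f m - g m)%R) <= l2energy f)%E.
  apply: le_esum => n _; rewrite lee_fin /g; case: ifP => _; last by rewrite subr0.
  by rewrite subrr sqmod0 sqmod_ge0.
move=> /le_lt_trans /(_ lf).
have := l2energy_ge0 (fun m => f m - g m).
case: (l2energy _) => [b| |] //= _ _.
by rewrite -!EFinD !lte_fin; lra.
Qed.

End LinearSpan.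

Section BlockEigenvectors.
Variables (R : realType) (x : int -> R * R) (N : int -> int).
Hypothesis xN : block_ends x N.
Hypothesis xpos : forall n, x n <> (0, 0) -> 0 < (x n).1 /\ 0 < (x n).2.

Let block_positive r (i : nat) : (i.+1 < block_size N r)%N ->
  0 < (x (block_site N r i)).1 /\ 0 < (x (block_site N r i)).2.
Proof.
move=> ir; apply: xpos; have := block_sizeE xN r => sE.
apply: (block_interior_neq0 xN (block_site_in xN (Ordinal (ltnW ir)))).
by rewrite /block_site /=; lia.
Qed.

Definition real_block r : 'M[R]_(block_size N r) :=
  \matrix_(i, j) entry x (block_site N r i) (block_site N r j).

Lemma blockE r : block x N r = map_mx (real_complex R) (real_block r).
Proof. by apply/matrixP => i j; rewrite !mxE. Qed.

Lemma real_block_super r (i j : 'I_(block_size N r)) : i.+1 = j ->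
  real_block r i j = (x (block_site N r i)).2.
Proof.
rewrite mxE /entry /block_site => ij; rewrite ifF; last by lia.
by rewrite ifT //; lia.
Qed.

Lemma real_block_sub r (i j : 'I_(block_size N r)) : j.+1 = i ->
  real_block r i j = (x (block_site N r j)).1.
Proof. by rewrite mxE /entry /block_site => ij; rewrite ifT //; lia. Qed.

Lemma real_block_far r (i j : 'I_(block_size N r)) : i.+1 != j -> j.+1 != i ->
  real_block r i j = 0.
Proof.
by rewrite mxE /entry /block_site => ij ji; rewrite !ifF //; lia.
Qed.

Lemma block_eigenvector_unique r l (u v : 'cV[R[i]]_(block_size N r)) :
  block x N r *m u = l *: u -> block x N r *m v = l *: v -> u != 0 ->
  exists c, v = c *: u.
Proof.
apply: hessenberg_eigenvector_unique => i j ij.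
  by rewrite blockE mxE real_block_far //; lia.
rewrite blockE mxE real_block_super // fmorph_eq0.
by have [_ /lt0r_neq0] := block_positive (leq_ltn_trans (eq_leq ij) (ltn_ord j)).
Qed.

(** The weights solve the detailed balance equations [w i * C i j = w j * C j
    i] along the path of sites. *)
Lemma block_diagonalizable r :
  exists (Q : 'M[R[i]]_(block_size N r)) (d : 'rV[R[i]]_(block_size N r)),
    Q \in unitmx /\ block x N r *m Q = Q *m diag_mx d.
Proof.
rewrite blockE.
pose w k := \prod_(t < k) ((x (block_site N r t)).2 / (x (block_site N r t)).1).
apply: (@symmetrizable_diagonalizable _ _ _ w) => [i|].
  apply: prodr_gt0 => t _.
  have [] := @block_positive r t (leq_ltn_trans (ltn_ord t) (ltn_ord i)).
  exact: divr_gt0 || by move=> *; rewrite divr_gt0.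
suff step (i j : 'I_(block_size N r)) : i.+1 = j ->
    w i * real_block r i j = w j * real_block r j i.
  move=> i j; have [|ij] := eqVneq i.+1 j; first exact: step.
  have [|ji] := eqVneq j.+1 i; first by move/step ->.
  by rewrite !real_block_far // !mulr0.
move=> ij; rewrite real_block_super // real_block_sub // -ij /w big_ord_recr /=.
have [p _] := block_positive (leq_ltn_trans (eq_leq ij) (ltn_ord j)).
by rewrite -mulrA divfK // lt0r_neq0.
Qed.

Lemma block_eigenvaluesP r l : block_eigenvalues x N r l <->
  exists2 u : 'cV[R[i]]_(block_size N r), u != 0 & block x N r *m u = l *: u.
Proof.
split=> [/eigenvalueP[u uE u0]|[u u0 uE]].
  exists u^T; first by rewrite -trmx_eq0 trmxK.
  by apply: trmx_inj; rewrite trmx_mul trmxK uE linearZ /= trmxK.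
apply/eigenvalueP; exists u^T; last by rewrite trmx_eq0.
by rewrite -trmx_mul uE linearZ.
Qed.

Lemma block_extend_eigenvector r l (u : 'cV[R[i]]_(block_size N r)) :
  u != 0 -> block x N r *m u = l *: u ->
  l2_eigenvector (tridiag_op x) l (block_extend u).
Proof.
move=> u0 uE; split; [exact: (block_extend_l2 xN)|exact: block_extend_neq0|].
by rewrite (tridiag_block_extend xN) uE (block_extendZ xN).
Qed.

Lemma countable_block_spectrum : countable (block_spectrum x N).
Proof.
apply: bigcup_countable; first exact: countableP.
move=> r _; apply: finite_set_countable.
have p0 : char_poly (block x N r)^T != 0 by rewrite monic_neq0 // char_poly_monic.
have [s sE] := closed_field_poly_normal (char_poly (block x N r)^T).
apply: (@sub_finite_set _ _ [set` s]); last exact: finite_seq.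
move=> l; rewrite /block_eigenvalues /= eigenvalue_root_char sE.
by rewrite rootZ ?root_prod_XsubC // lead_coef_eq0.
Qed.

Lemma block_eigenfamily_exists : exists v, block_eigenfamily x N v.
Proof.
pose P r l f := block_eigenvalues x N r l ->
  exists u : 'cV[R[i]]_(block_size N r),
    [/\ u != 0, block x N r *m u = l *: u & f = block_extend u].
have ex r l : exists f, P r l f.
  case: (pselect (block_eigenvalues x N r l)) => [h|h]; last by exists (fun=> 0).
  have [u u0 uE] := (block_eigenvaluesP r l).1 h.
  by exists (block_extend u) => _; exists u.
exists (fun r l => projT1 (cid (ex r l))) => r l; exact: (projT2 (cid (ex r l))).
Qed.

Variable v : int -> R[i] -> int -> R[i].
Hypothesis xv : block_eigenfamily x N v.

Lemma block_eigenvectors_l2 : block_eigenvectors x N v `<=` @l2 R.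
Proof. by move=> _ [r [l [/xv[u [_ _ ->]] ->]]]; exact: (block_extend_l2 xN). Qed.

Lemma block_extend_span r (z : 'cV[R[i]]_(block_size N r)) :
  linear_span (block_eigenvectors x N v) (block_extend z).
Proof.
have [Q [d [Qu QE]]] := block_diagonalizable r.
have zE : z = \sum_j (invmx Q *m z) j 0 *: col j Q.
  rewrite -[LHS]mul1mx -(mulmxV Qu) -mulmxA; apply/matrixP => i j.
  rewrite ord1 [LHS]mxE summxE; apply: eq_bigr => k _.
  by rewrite !mxE mulrC.
rewrite zE; elim/big_ind: _ => [|z1 z2 s1 s2|j _].
- by rewrite (block_extend0 xN); exact: linear_span0.
- by rewrite (block_extendD xN); exact: linear_spanD.
rewrite (block_extendZ xN); apply: linear_spanZ.
have cE : block x N r *m col j Q = d 0 j *: col j Q.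
  rewrite {1}colE mulmxA QE -colE mul_mx_diag; apply/matrixP => i k.
  by rewrite !mxE mulrC.
have c0 : col j Q != 0.
  apply/eqP => /(congr1 (mulmx (invmx Q))).
  rewrite colE mulmxA mulVmx // mul1mx mulmx0 => /matrixP/(_ j 0).
  by rewrite !mxE !eqxx => /eqP; rewrite oner_eq0.
have dj : block_eigenvalues x N r (d 0 j) by apply/block_eigenvaluesP; exists (col j Q).
have [u [u0 uE vE]] := xv dj.
have [c ->] := block_eigenvector_unique uE cE u0.
rewrite (block_extendZ xN); apply: linear_spanZ; rewrite -vE.
by apply: linear_span_sub; exists r, (d 0 j).
Qed.

Lemma block_eigenvectors_dense : l2_dense (linear_span (block_eigenvectors x N v)).
Proof.
apply: linear_span_dense => [|k]; first exact: block_eigenvectors_l2.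
have [r kr] := in_block_exists xN k.
have [i kE] := in_blockP xN kr.
rewrite (_ : (fun m => _) = block_extend (delta_mx i 0 : 'cV[R[i]]_(block_size N r))).
  exact: block_extend_span.
apply/esym/(block_extendP xN) => [j|m mr].
  rewrite kE mxE eqxx andbT; congr (nat_of_bool _)%:R.
  apply/eqP/eqP => [|->//]; rewrite /block_site => ji; apply: val_inj => /=; lia.
by case: eqP => // mk; rewrite mk kr in mr.
Qed.

End BlockEigenvectors.

(** * Blocks with constant entries *)

Section ConstantBlocks.
Variables (R : realType) (x : int -> R * R) (a b : R).
Hypothesis a0 : 0 < a.
Implicit Types (k : int) (m : nat) (f : int -> R[i]).

Definition constant_block k m : Prop :=
  [/\ x k = (0, 0), forall i : nat, (i < m.*2)%N -> x (k + 1 + i%:Z) = (a, b)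
    & x (k + 1 + m.*2%:Z) = (0, 0)].

(** A zero entry ends a constant block, so two such blocks that share a site
    coincide. *)
Lemma constant_block_disjoint k m k' m' (y : int) :
  constant_block k m -> constant_block k' m' ->
  k < y -> y <= k + 1 + m.*2%:Z -> k' < y -> y <= k' + 1 + m'.*2%:Z -> m = m'.
Proof.
move=> [x0 xab xe] [x0' xab' xe'] ky yk ky' yk'.
have inner l n z : (forall i : nat, (i < n.*2)%N -> x (l + 1 + i%:Z) = (a, b)) ->
    l < z -> z < l + 1 + n.*2%:Z -> x z <> (0, 0).
  move=> xl lz zl; rewrite (_ : z = l + 1 + (absz (z - l - 1)%R)%:Z); last by lia.
  by rewrite xl; [case=> aE; move: a0; rewrite aE ltxx|lia].
have kk' : k = k'.
  have [lt|lt|//] := ltgtP k k'.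
    by case: (@inner k m k' xab lt _ x0'); lia.
  by case: (@inner k' m' k xab' lt _ x0); lia.
rewrite -{}kk' in xab' xe' *.
have [lt|lt|//] := ltngtP m m'.
  by case: (@inner k m' _ xab' _ _ xe); lia.
by case: (@inner k m _ xab _ _ xe'); lia.
Qed.

Hypothesis b0 : 0 < b.

(** Pairing with the left kernel vector of the constant block that starts
    after site [k]; it is supported on every other site. *)
Definition left_null k m f : R[i] :=
  \sum_(j < m.+1) ((- (b / a)) ^+ j)%:C * f (k + 1 + j.*2%:Z).

(** The partial sums telescope: after the terms [j <= n] only the contribution
    of the site [k + 2 + 2 n] is left, and at the end of the block it cancels. *)
Lemma left_null_range k m f : constant_block k m ->
  left_null k m (tridiag_op x f) = 0.
Proof.
move=> [x0 xab xe]; rewrite /left_null.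
have step n : (n < m)%N ->
  \sum_(j < n.+1) ((- (b / a)) ^+ j)%:C * tridiag_op x f (k + 1 + j.*2%:Z) =
  ((- (b / a)) ^+ n * b)%:C * f (k + 2 + n.*2%:Z).
  elim: n => [|n IH] nm.
    rewrite big_ord1 expr0 !mul1r tridiag_opE double0 addr0 addrK x0 mul0r add0r.
    rewrite -[k + 1]addr0 (xab 0%N) /=; last by lia.
    by rewrite (_ : k + 1 + 0 + 1 = k + 2 + 0); last by lia.
  rewrite big_ord_recr /= IH ?(ltnW nm) // tridiag_opE.
  rewrite (_ : k + 1 + n.+1.*2%:Z - 1 = k + 1 + n.*2.+1%:Z); last by lia.
  rewrite !xab /=; try by lia.
  rewrite (_ : k + 1 + n.*2.+1%:Z = k + 2 + n.*2%:Z); last by lia.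
  rewrite (_ : k + 1 + n.+1.*2%:Z + 1 = k + 2 + n.+1.*2%:Z); last by lia.
  rewrite mulrDr !mulrA -!rmorphM addrA -mulrDl -rmorphD.
  rewrite (_ : _ + _ = 0) ?mul0r ?add0r //.
  by rewrite exprSr; field; rewrite lt0r_neq0.
case: m xab xe step => [|m] xab xe step.
  rewrite big_ord1 tridiag_opE double0 addr0 addrK x0.
  by rewrite double0 addr0 in xe; rewrite xe !mul0r addr0 mulr0.
rewrite big_ord_recr /= step // tridiag_opE xe mul0r addr0.
rewrite (_ : k + 1 + m.+1.*2%:Z - 1 = k + 1 + m.*2.+1%:Z); last by lia.
rewrite xab /=; last by lia.
rewrite (_ : k + 1 + m.*2.+1%:Z = k + 2 + m.*2%:Z); last by lia.
rewrite mulrA -!rmorphM -mulrDl -rmorphD.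
rewrite (_ : _ + _ = 0) ?mul0r //.
by rewrite exprSr; field; rewrite lt0r_neq0.
Qed.

Lemma null_vectorE k m f : constant_block k m -> tridiag_op x f = (fun=> 0) ->
  forall j, (j <= m)%N -> f (k + 1 + j.*2%:Z) = ((- (a / b)) ^+ j)%:C * f (k + 1).
Proof.
move=> [x0 xab xe] Tf; elim=> [|j IH] jm; first by rewrite double0 addr0 expr0 mul1r.
have := congr1 (fun g => g (k + 1 + j.*2.+1%:Z)) Tf.
rewrite tridiag_opE (_ : k + 1 + j.*2.+1%:Z - 1 = k + 1 + j.*2%:Z); last by lia.
rewrite !xab /=; try by lia.
rewrite (_ : k + 1 + j.*2.+1%:Z + 1 = k + 1 + j.+1.*2%:Z); last by lia.
rewrite IH ?(ltnW jm) // => /eqP; rewrite addrC addr_eq0 => /eqP bE.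
have bC : b%:C != 0 by rewrite fmorph_eq0 lt0r_neq0.
apply: (mulfI bC); rewrite bE exprS !mulrA -!rmorphM -mulNr -rmorphN.
congr (_%:C * _); rewrite mulrA mulrN mulrCA divff ?mulr1 ?mulNr //.
exact: lt0r_neq0.
Qed.

Lemma left_null_null_vector k m f : constant_block k m ->
  tridiag_op x f = (fun=> 0) -> left_null k m f = m.+1%:R * f (k + 1).
Proof.
move=> xk Tf; rewrite /left_null.
rewrite (eq_bigr (fun=> f (k + 1))) => [|j _].
  by rewrite sumr_const card_ord mulr_natl.
rewrite (null_vectorE xk Tf) ?leq_ord // mulrA -rmorphM -exprMn.
by rewrite mulrNN mulrA divfK ?lt0r_neq0 // divff ?lt0r_neq0 // expr1n mul1r.
Qed.

(** The functional vanishes on [l * f], as this is in the range. *)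
Lemma left_null_eigenvector k m l f : constant_block k m ->
  tridiag_op x f = (fun n => l * f n) -> left_null k m f != 0 -> l = 0.
Proof.
move=> xk Tf; apply: contra_neq_eq => l0.
have := left_null_range f xk; rewrite Tf /left_null.
under eq_bigr do rewrite mulrCA.
by rewrite -mulr_sumr => /eqP; rewrite mulf_eq0 (negPf l0) /= => /eqP.
Qed.

Lemma left_null_sum k m n (c : 'I_n -> R[i]) (F : 'I_n -> int -> R[i]) :
  left_null k m (fun p => \sum_(i < n) c i * F i p) =
  \sum_(i < n) c i * left_null k m (F i).
Proof.
rewrite /left_null; under eq_bigr do rewrite mulr_sumr.
rewrite exchange_big; apply: eq_bigr => i _; rewrite mulr_sumr.
by apply: eq_bigr => j _; rewrite mulrCA.
Qed.

Lemma left_nullB k m f g :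
  left_null k m (fun p => f p - g p) = left_null k m f - left_null k m g.
Proof.
by rewrite /left_null -sumrB; apply: eq_bigr => j _; rewrite mulrBr.
Qed.

End ConstantBlocks.

(** * Norm convergent expansions *)

Section GeometricSequences.
Variable R : realType.

Lemma bernoulli_inequality (e : R) m : 0 <= e -> 1 + m%:R * e <= (1 + e) ^+ m.
Proof.
move=> e0; elim: m => [|m IH]; first by rewrite mul0r addr0 expr0.
rewrite exprS; apply: (@le_trans _ _ ((1 + e) * (1 + m%:R * e))); last first.
  by rewrite ler_wpM2l // addr_ge0.
have : 0 <= m%:R * e * e by rewrite !mulr_ge0.
by rewrite -natr1; nra.
Qed.

Lemma geometric_esum (s : R) : 0 < s < 1 ->
  (\esum_(m in [set: nat]) (s ^+ m)%:E < +oo)%E.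
Proof.
move=> /andP[s0 s1].
have nng n : (0 <= (s ^+ n)%:E)%E by rewrite lee_fin exprn_ge0 // ltW.
rewrite -nneseries_esumT //; apply: (@le_lt_trans _ _ (1 / (1 - s))%:E); last exact: ltry.
apply: lime_le; first by apply: is_cvg_nneseries => n _ _.
near=> n; rewrite sumEFin lee_fin.
apply: le_trans (@geometric_le_lim R n 1 s _ s0 _) => //; last by rewrite ger0_norm // ltW.
by rewrite /series /geometric /=; apply: ler_sum => i _; rewrite mul1r.
Unshelve. all: by end_near. Qed.

(** The test vector for the basis property: geometrically decaying masses at
    prescribed sites. *)
Lemma geometric_point_masses (p : nat -> int) (s : R) : injective p -> 0 < s < 1 ->
  exists f : int -> R[i], [/\ l2 f, forall m, f (p m) = (s ^+ m)%:C
    & forall n, ~ range p n -> f n = 0].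
Proof.
move=> pinj s01; have /andP[s0 s1] := s01.
pose f (n : int) : R[i] :=
  if n \in range p then (s ^+ xget 0%N [set m | p m = n])%:C else 0.
have fp m : f (p m) = (s ^+ m)%:C.
  rewrite /f mem_set; last by exists m.
  congr (s ^+ _)%:C; apply: pinj.
  by have := @xgetPex _ 0%N [set m' | p m' = p m] (ex_intro _ m erefl).
exists f; split => // [|n np]; last by rewrite /f memNset.
apply/l2P; apply: le_lt_trans (@geometric_esum (s ^+ 2) _); last first.
  by rewrite exprn_gt0 //= expr_lt1 // ltW.
rewrite [X in (_ <= X)%E](_ : _ = \esum_(n in range p) (sqmod (f n))%:E).
  rewrite [X in (_ <= X)%E]esum_mkcond; apply: le_esum => n _.
  by rewrite /f; case: ifP => // _; rewrite sqmod0.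
rewrite esum_image; last by move=> ? ? _ _; exact: pinj.
by apply: eq_esum => m _; rewrite fp sqmod_real -exprM mulnC exprM.
Qed.

End GeometricSequences.

Section SchauderExpansions.
Variable R : realType.

Lemma sqmod_sum n (F : 'I_n -> R[i]) :
  sqmod (\sum_(i < n) F i) <= 2 ^+ n * \sum_(i < n) sqmod (F i).
Proof.
elim: n F => [|n IH] F; first by rewrite !big_ord0 sqmod0 mulr0.
rewrite !big_ord_recr /= (le_trans (sqmodD _ _)) // exprS -mulrA ler_pM2l //.
rewrite mulrDr lerD //; rewrite ler_peMl ?sqmod_ge0 //.
by rewrite exprn_ege1 // ler1n.
Qed.

Lemma sqmod_eq0 (z : R[i]) : sqmod z <= 0 -> z = 0.
Proof.
case: z => u v; rewrite /sqmod /= => uv.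
have u2 := sqr_ge0 u; have v2 := sqr_ge0 v.
have /eqP : u ^+ 2 = 0 by lra.
have /eqP : v ^+ 2 = 0 by lra.
by rewrite !sqrf_eq0 => /eqP -> /eqP ->.
Qed.

(** Each coordinate is bounded by the norm, so convergence in norm is uniform
    over the coordinates. *)
Lemma l2norm_cvg0 (g : nat -> int -> R[i]) :
  l2norm (g n) @[n --> \oo] --> (0 : \bar R) ->
  forall eps : R, 0 < eps -> exists M, forall n, (M <= n)%N ->
    forall p, sqmod (g n p) < eps.
Proof.
move=> gcvg eps e0.
have s0 : 0 < Num.sqrt eps by rewrite sqrtr_gt0.
have := gcvg _ (open_ereal_lt' (x := 0%E) (y := (Num.sqrt eps)%:E) _).
rewrite lte_fin => /(_ s0) [M _ HM]; exists M => n Mn p.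
have := HM n Mn; rewrite /= l2norm_lt // sqr_sqrtr ?ltW // => lt.
by rewrite -lte_fin; apply: le_lt_trans lt; exact: sqmod_le_energy.
Qed.

Lemma left_null_small (a b : R) k m (g : nat -> int -> R[i]) (D : R[i]) K :
  l2norm (g n) @[n --> \oo] --> (0 : \bar R) ->
  (forall n, (K <= n)%N -> left_null a b k m (g n) = D) -> D = 0.
Proof.
move=> gcvg gD; apply: sqmod_eq0; apply/ler_addgt0Pl => /= e e0; rewrite addr0.
pose c (j : 'I_m.+1) : R := sqmod ((- (b / a)) ^+ j)%:C.
pose C := 2 ^+ m.+1 * (1 + \sum_j c j).
have C0 : 0 < C.
  by rewrite mulr_gt0 ?exprn_gt0 // ltr_wpDr // sumr_ge0 // => j _; exact: sqmod_ge0.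
have [M HM] := l2norm_cvg0 gcvg (divr_gt0 e0 C0).
rewrite -(gD (maxn K M)) ?leq_maxl // /left_null (le_trans (sqmod_sum _)) //.
apply: (@le_trans _ _ (2 ^+ m.+1 * \sum_(j < m.+1) c j * (e / C))).
  rewrite ler_wpM2l ?exprn_ge0 //; apply: ler_sum => j _; rewrite sqmodM.
  by rewrite ler_wpM2l ?sqmod_ge0 // ltW // HM // leq_maxr.
rewrite -mulr_suml mulrA; apply: (@le_trans _ _ (C * (e / C))).
  apply: ler_wpM2r; first by rewrite ltW ?divr_gt0.
  by rewrite /C ler_wpM2l ?exprn_ge0 // lerDr.
by rewrite mulrC divfK // lt0r_neq0.
Qed.

End SchauderExpansions.

(** * Block eigenvectors do not form a basis *)

Section NotABasis.
Variables (R : realType) (x : int -> R * R) (N : int -> int).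
Variables (v : int -> R[i] -> int -> R[i]) (a b : R).
Hypotheses (xN : block_ends x N) (xv : block_eigenfamily x N v).
Hypotheses (a0 : 0 < a) (b0 : 0 < b).

(** Among all block eigenvectors, the functional only sees the kernel vector
    of the block that contains [k + 1]. *)
Lemma left_null_detects k m f : constant_block x a b k m ->
  block_eigenvectors x N v f -> left_null a b k m f != 0 ->
  exists r, [/\ in_block N r (k + 1), f = v r 0, tridiag_op x f = (fun=> 0)
    & f (k + 1) != 0].
Proof.
move=> xk [r [l [rl ->]]] Lf.
have [u [u0 uE vE]] := xv rl.
have [_ _ Tv] := block_extend_eigenvector xN u0 uE.
rewrite -vE in Tv; have l0 := left_null_eigenvector a0 b0 xk Tv Lf.
have Tv0 : tridiag_op x (v r l) = fun=> 0.
  by rewrite Tv l0; apply/funext => n; rewrite mul0r.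
have fk : v r l (k + 1) != 0.
  by apply: contra_neq Lf => fk; rewrite (left_null_null_vector a0 b0 xk Tv0) fk mulr0.
exists r; split => //; last by rewrite l0.
by apply: contraNT fk => kr; rewrite vE (block_extend_out xN).
Qed.

Lemma constant_block_start k m r : constant_block x a b k m ->
  in_block N r (k + 1) -> k = N (r - 1).
Proof.
move=> [x0 _ _] kr.
have [s _ sk] : range N k by case: xN => _ _ _ ->.
have : s < r by rewrite ltNge; apply/negP => /(block_ends_le xN); move: kr; rewrite /in_block; lia.
have : r - 1 <= s.
  by rewrite leNgt; apply/negP => /(block_ends_lt xN); move: kr; rewrite /in_block; lia.
by move=> rs sr; rewrite (_ : r - 1 = s) //; lia.
Qed.

(** In the branch [b < a] the kernel vector grows along the block, so the mass
    is put at its first site [p m] and the expansion term is tested at the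
    last one [q m]; for [a < b] it decays and the two sites are exchanged. The
    inequality of Bernoulli bounds the tested terms from below by [min 1 de]
    with [1 + de = rho * s]. *)
Lemma constant_blocks_not_basis : a != b ->
  (forall m, exists k, constant_block x a b k m) ->
  ~ l2_basis (block_eigenvectors x N v).
Proof.
move=> ab pat [e [[eV einj _] [el2 eb]]].
pose k m := projT1 (cid (pat m)).
have kP m : constant_block x a b (k m) m by exact: projT2 (cid (pat m)).
pose jp m := if b < a then 0%N else m.
pose jq m := if b < a then m else 0%N.
pose rho := if b < a then a / b else b / a.
have rho1 : 1 < rho.
  rewrite /rho; case: ifPn => [ba|]; first by rewrite ltr_pdivlMr ?mul1r.
  by rewrite -leNgt le_eqVlt (negPf ab) /= => lt; rewrite ltr_pdivlMr ?mul1r.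
have jpm m : (jp m <= m)%N by rewrite /jp; case: ifP.
have jqm m : (jq m <= m)%N by rewrite /jq; case: ifP.
pose p m : int := k m + 1 + (jp m).*2%:Z.
pose q m : int := k m + 1 + (jq m).*2%:Z.
have interval m m' (y : int) : k m < y -> y <= k m + 1 + m.*2%:Z ->
    k m' < y -> y <= k m' + 1 + m'.*2%:Z -> m = m'.
  exact: (constant_block_disjoint a0 (kP m) (kP m')).
have pinj : injective p.
  move=> m m'; rewrite /p => pE; have jm := jpm m; have jm' := jpm m'.
  by apply: (interval m m' (p m)); rewrite /p; clear -pE jm jm'; lia.
pose s : R := (1 + rho^-1) / 2.
have rho0 : 0 < rho by lra.
have s01 : 0 < s < 1.
  have : 0 < rho^-1 by rewrite invr_gt0.
  have : rho^-1 < 1 by rewrite invf_lt1.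
  by rewrite /s; move=> ? ?; apply/andP; split; lra.
pose de := (rho - 1) / 2.
have de0 : 0 < de by rewrite /de; lra.
have rhos : rho * s = 1 + de.
  by rewrite /s /de; field; rewrite lt0r_neq0.
have [f [fl2 fp f0]] := geometric_point_masses pinj s01.
have [c [fc _]] := eb f fl2.
pose g n (y : int) := f y - \sum_(i < n) c i * e i y.
have Lf m : left_null a b (k m) m f = ((- (b / a)) ^+ jp m * s ^+ m)%:C.
  rewrite /left_null (bigD1 (Ordinal (jpm m : (jp m < m.+1)%N))) //=.
  rewrite -/(p m) fp -rmorphM big1 ?addr0 // => j jj.
  rewrite f0 ?mulr0 // => -[m' _ pE].
  have mm' : m = m'.
    have jm := ltn_ord j; have jm' := jpm m'.
    by apply: (interval m m' (p m')); rewrite /p in pE *; clear -pE jm jm'; lia.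
  move/eqP: jj; apply; apply: val_inj => /=; move: pE; rewrite -mm' /p; clear; lia.
have Lf0 m : left_null a b (k m) m f != 0.
  have /andP[/lt0r_neq0 s0 _] := s01.
  have ba0 : - (b / a) != 0 by rewrite oppr_eq0 lt0r_neq0 // divr_gt0.
  by rewrite Lf fmorph_eq0 mulf_neq0 // expf_neq0.
have Lg n m : left_null a b (k m) m (g n) = left_null a b (k m) m f -
    \sum_(i < n) c i * left_null a b (k m) m (e i).
  by rewrite /g left_nullB left_null_sum.
(* If the [m]-th functional killed every [e i], it would kill all partial sums
   of the expansion of [f], hence [f]. *)
have kaex m : exists i, left_null a b (k m) m (e i) != 0.
  apply: contrapT => no; move/eqP: (Lf0 m); apply.
  apply: (@left_null_small _ a b (k m) m g _ 0 fc) => n _.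
  rewrite Lg big1 ?subr0 // => i _; apply/eqP; rewrite mulf_eq0 orbC.
  by apply/orP; left; apply: contrapT => h; apply: no; exists i; exact/negP.
pose ka m := projT1 (cid (kaex m)).
have kaP m : left_null a b (k m) m (e (ka m)) != 0 by exact: projT2 (cid (kaex m)).
have eVi i : block_eigenvectors x N v (e i) by exact: eV.
(* So the enumeration contains, at the index [ka m], the kernel vector of the
   [m]-th block, and it is the only vector that this functional sees. *)
have kaU m i : left_null a b (k m) m (e i) != 0 -> i = ka m.
  move=> Li; apply: einj; rewrite ?inE //.
  have [r [kr -> _ _]] := left_null_detects (kP m) (eVi i) Li.
  have [r' [kr' -> _ _]] := left_null_detects (kP m) (eVi (ka m)) (kaP m).
  by rewrite (in_block_inj xN kr kr').
have coef m : c (ka m) * left_null a b (k m) m (e (ka m)) = left_null a b (k m) m f.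
  apply/esym/eqP; rewrite -subr_eq0; apply/eqP.
  apply: (@left_null_small _ a b (k m) m g _ (ka m).+1 fc) => n kn.
  rewrite Lg (bigD1 (Ordinal kn)) //= big1 ?addr0 // => i ik.
  apply/eqP; rewrite mulf_eq0; apply/orP; right; apply: contraNT ik => /kaU iE.
  by apply/eqP/val_inj.
(* Different blocks have different kernel vectors, so [ka] is unbounded. *)
have kainj : injective ka.
  move=> m m' kE.
  have [r [kr erE _ _]] := left_null_detects (kP m) (eVi _) (kaP m).
  have [r' [kr' erE' _ nz]] := left_null_detects (kP m') (eVi _) (kaP m').
  have nz' : e (ka m) (k m' + 1) != 0 by rewrite kE.
  have rr' : r = r'.
    have [r1 [l1 [rl1 e1]]] := eVi (ka m).
    have [u1 [_ _ v1]] := xv rl1.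
    have inb y : e (ka m) y != 0 -> in_block N r1 y.
      by apply: contraNT => yr; rewrite e1 v1 (block_extend_out xN).
    have [r2 [kr2 _ _ nz2]] := left_null_detects (kP m) (eVi _) (kaP m).
    by rewrite (in_block_inj xN kr (inb _ nz2)) (in_block_inj xN kr' (inb _ nz')).
  have kk : k m = k m'.
    by rewrite (constant_block_start (kP m) kr) rr' -(constant_block_start (kP m') kr').
  by apply: (interval m m' (k m + 1)); rewrite -?kk; clear; lia.
(* The term has entry [s ^+ m / m.+1] times a power of [- (b / a)] at [k m + 1],
   and at [q m] this gains a power of [- (a / b)]; together the two powers have
   absolute value [rho ^+ m]. *)
have large m : Num.min 1 de ^+ 2 <= sqmod (c (ka m) * e (ka m) (q m)).
  have [r [_ _ Te _]] := left_null_detects (kP m) (eVi _) (kaP m).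
  have := coef m; rewrite (left_null_null_vector a0 b0 (kP m) Te) Lf => cE.
  rewrite /q (null_vectorE a0 b0 (kP m) Te) // mulrCA sqmodM sqmod_real.
  have := congr1 (@sqmod R) cE; rewrite mulrCA sqmodM sqmod_real.
  rewrite sqmod_nat => sE.
  have m10 : (m.+1%:R : R) != 0 by rewrite pnatr_eq0.
  have -> : sqmod (c (ka m) * e (ka m) (k m + 1)) =
     ((- (b / a)) ^+ jp m * s ^+ m) ^+ 2 / m.+1%:R ^+ 2.
    by rewrite -sE mulrAC divff ?mul1r // expf_neq0.
  have -> : ((- (a / b)) ^+ jq m) ^+ 2 * (((- (b / a)) ^+ jp m * s ^+ m) ^+ 2 / m.+1%:R ^+ 2) =
    ((rho * s) ^+ m / m.+1%:R) ^+ 2.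
    have sqE (t : R) j : ((- t) ^+ j) ^+ 2 = (t ^+ j) ^+ 2.
      by rewrite -!exprM mulnC !exprM sqrrN.
    have rhoE : ((- (a / b)) ^+ jq m) ^+ 2 * ((- (b / a)) ^+ jp m) ^+ 2 = (rho ^+ m) ^+ 2.
      by rewrite !sqE /jp /jq /rho; case: ifP => _; rewrite expr0 expr1n ?mulr1 ?mul1r.
    rewrite [in LHS]exprMn mulrA mulrA rhoE.
    by rewrite [RHS]expr_div_n [in RHS]exprMn [in RHS]exprMn.
  rewrite ler_sqr ?nnegrE; last 2 first.
  - by rewrite le_min ler01 ltW.
  - by rewrite divr_ge0 ?exprn_ge0 // rhos addr_ge0 // ltW.
  rewrite ler_pdivlMr ?ltr0Sn // rhos; apply: le_trans (bernoulli_inequality m (ltW de0)).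
  have : Num.min 1 de <= 1 by rewrite ge_min lexx.
  have : Num.min 1 de <= de by rewrite ge_min lexx orbT.
  have : 0 <= m%:R :> R by [].
  by rewrite -natr1; nra.
(* The term of index [ka m] is the difference of two remainders, so its squared
   modulus is at most [4 * eps], which is less than its lower bound. *)
pose eps := Num.min 1 de ^+ 2 / 5.
have eps0 : 0 < eps by rewrite divr_gt0 ?exprn_gt0 ?lt_min ?ltr01.
have [M HM] := l2norm_cvg0 fc eps0.
have [m Mm] : exists m, (M <= ka m)%N.
  apply: contrapT => no.
  have kM m : (ka m < M)%N by rewrite ltnNge; apply/negP => h; apply: no; exists m.
  have /leq_card : injective (fun i : 'I_M.+1 => Ordinal (kM i)).
    by move=> i j [/kainj /val_inj].
  by rewrite !card_ord ltnn.
have := large m.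
have -> : c (ka m) * e (ka m) (q m) = g (ka m) (q m) + - g (ka m).+1 (q m).
  by rewrite /g big_ord_recr /=; ring.
have := sqmodD (g (ka m) (q m)) (- g (ka m).+1 (q m)).
have := HM _ Mm (q m); have := HM _ (leqW Mm) (q m).
rewrite -!/(g _ _) sqmodN /eps; set A := sqmod _; set B := sqmod _; set D := sqmod _.
have : 0 < Num.min 1 de ^+ 2 by rewrite exprn_gt0 ?lt_min ?ltr01.
set mu := _ ^+ 2; lra.
Qed.

End NotABasis.

(** * Words in an independent sequence *)

Section AlmostSure.
Variables (R : realType) (d : measure_display) (Om : measurableType d).
Variable P : probability Om R.

Lemma ae_forall_countable (T : countType) (Q : T -> Om -> Prop) :
  (forall t, {ae P, forall w, Q t w}) -> {ae P, forall w, forall t, Q t w}.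
Proof.
move=> aeQ.
have h (n : nat) : {ae P, forall w, if unpickle n is Some t then Q t w else True}.
  by case: (unpickle n : option T) => [t|]; [exact: aeQ|exact: aeW].
apply: filterS (ae_foralln h) => w Qw t.
by have := Qw (pickle t); rewrite pickleK.
Qed.

Lemma measurable_point (c : R * R) : measurable [set c].
Proof.
case: c => u v; rewrite (_ : [set (u, v)] = [set u] `*` [set v]).
  by apply: measurableX; exact: measurable_set1.
by apply/seteqP; split => [_ ->|[? ?] /= [-> ->]].
Qed.

Lemma measurable_finite_points (A : set (R * R)) : finite_set A -> measurable A.
Proof.
move=> finA; rewrite (_ : A = \bigcup_(c in A) [set c]).
  by apply: fin_bigcup_measurable => // c _; exact: measurable_point.
by apply/seteqP; split => [c Ac|_ [c Ac ->] //]; exists c.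
Qed.

Lemma finite_null (mu : probability (R * R)%type R) (s : seq (R * R)) :
  (forall c, c \in s -> mu [set c] = 0%E) -> mu [set` s] = 0%E.
Proof.
elim: s => [|c s IH] s0; first by rewrite set_nil measure0.
apply/eqP; rewrite eq_le measure_ge0 andbT.
rewrite (_ : [set` c :: s] = [set c] `|` [set` s]); last first.
  apply/seteqP; split => y /=; rewrite inE.
    by case/predU1P; [left|right].
  by case=> [->|ys]; rewrite ?eqxx // ys orbT.
have ms : measurable [set` s] := measurable_finite_points (finite_seq s).
apply: (@le_trans _ _ (mu [set c] + mu [set` s])%E); first exact: measureU2 (measurable_point c) ms.
rewrite s0 ?mem_head // add0e IH // => y ys.
by apply: s0; rewrite inE ys orbT.
Qed.

Variables (mu : probability (R * R)%type R) (X : int -> {RV P >-> (R * R)%type}).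
Hypothesis iidX : iid_with_law mu X.

Lemma law_preimage n (B : set (R * R)) : measurable B -> P (X n @^-1` B) = mu B.
Proof. by move=> mB; rewrite -(iidX.2 n B mB). Qed.

(** The complement of [F] and the finitely many points of [F] without mass
    form a null set. *)
Lemma values_in_atoms (F : set (R * R)) : finite_set F -> mu F = 1%E ->
  {ae P, forall w, forall n, F (X n w) /\ (0 < mu [set X n w])%E}.
Proof.
move=> finF muF; apply: ae_forall_countable => n.
have /finite_seqP[s sF] := finF.
pose z := [seq c <- s | `[< mu [set c] = 0%E >]].
have mF := measurable_finite_points finF.
have mz : measurable [set` z] by exact: measurable_finite_points (finite_seq _).
have z0 : mu [set` z] = 0%E.
  by apply: finite_null => c; rewrite mem_filter => /andP[/asboolP].
have B0 : mu (~` F `|` [set` z]) = 0%E.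
  apply/eqP; rewrite eq_le measure_ge0 andbT.
  apply: (@le_trans _ _ (mu (~` F) + mu [set` z])%E).
    exact: measureU2 (measurableC mF) mz.
  by rewrite z0 adde0 probability_setC // muF -EFinB subrr.
exists (X n @^-1` (~` F `|` [set` z])); split.
- rewrite -[X in measurable X]setTI; apply: (measurable_funP (X n)) => //.
  by apply: measurableU => //; exact: measurableC.
- by rewrite law_preimage //; apply: measurableU => //; exact: measurableC.
move=> w /= /not_andP[nF|mu0]; first by left.
have [FX|] := pselect (F (X n w)); last by left.
right; rewrite mem_filter; apply/andP; split; last by rewrite sF in FX.
apply/asboolP/eqP; rewrite eq_le measure_ge0 andbT leNgt; exact/negP.
Qed.

Section Words.
Variables (L : nat) (c : nat -> R * R) (pos : nat -> nat -> int).
Hypothesis posinj : forall j i j' i', (i < L)%N -> (i' < L)%N ->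
  pos j i = pos j' i' -> j = j' /\ i = i'.
Hypothesis c0 : forall i, (i < L)%N -> (0 < mu [set c i])%E.

Let occurs j : set Om := [set w | forall i, (i < L)%N -> X (pos j i) w = c i].

Let q : R := \prod_(i < L) fine (mu [set c i]).

(** The condition on the entry at site [n] imposed by the windows: one
    prescribed value if [n] lies in a window, no constraint otherwise. *)
Let letter n : set (R * R) := 
  [set y | forall j i, (i < L)%N -> n = pos j i -> y = c i].

Let letterE j i : (i < L)%N -> letter (pos j i) = [set c i].
Proof.
move=> iL; apply/seteqP; split => [y /(_ j i iL erefl) //|_ -> j' i' iL' pE].
by have [_ ->] := posinj iL iL' pE.
Qed.

Let measurable_letter n : measurable (letter n).
Proof.
have [[j [i [iL ->]]]|no] := pselect (exists j i, (i < L)%N /\ n = pos j i).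
  by rewrite letterE //; exact: measurable_point.
rewrite (_ : letter n = setT) //; apply/seteqP; split => // y _ j i iL nE.
by exfalso; apply: no; exists j, i.
Qed.

Let measurable_occurs j : measurable (occurs j).
Proof.
rewrite (_ : occurs j = \bigcap_(i in `I_L) (X (pos j i) @^-1` [set c i])) //.
apply: fin_bigcap_measurable; first exact: finite_II.
move=> i _; rewrite -[X in measurable X]setTI.
by apply: (measurable_funP (X (pos j i))) => //; exact: measurable_point.
Qed.

Let prob_all (J : seq nat) : uniq J ->
  P (\bigcap_(j in [set` J]) occurs j) = (q ^+ size J)%:E.
Proof.
move=> uJ; pose sites := [seq pos j i | j <- J, i <- iota 0 L].
have usites : uniq sites.
  apply: allpairs_uniq => //; first exact: iota_uniq.
  move=> [j i] [j' i'] /allpairsP[[j1 i1] [_ i1L [-> ->]]].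
  move=> /allpairsP[[j2 i2] [_ i2L [-> ->]]] /=.
  rewrite !mem_iota /= in i1L i2L.
  by move=> /(posinj i1L i2L)[-> ->].
transitivity (P (\bigcap_(n in [set` sites]) X n @^-1` letter n)).
  congr (P _); apply/seteqP; split => w /= h.
    move=> n /= /allpairsP[[j i] [/= jJ iL ->]].
    rewrite mem_iota /= in iL; rewrite letterE //=; exact: (h j jJ).
  move=> j /= jJ i iL.
  have : pos j i \in sites by apply/allpairsP; exists (j, i); rewrite /= mem_iota.
  by move=> /h; rewrite /= letterE.
rewrite (iidX.1 sites letter usites measurable_letter).
rewrite /sites big_allpairs_dep /=.
rewrite (eq_bigr (fun=> q%:E)) => [|j _].
  elim: (J) => [|j s IH] /=; first by rewrite big_nil.
  by rewrite big_cons IH exprS EFinM.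
rewrite /q (big_morph (@EFin R) (@EFinM R) erefl).
rewrite -[in RHS](big_mkord xpredT (fun i => (fine (mu [set c i]))%:E)).
rewrite /index_iota subn0; apply: eq_big_seq => i; rewrite mem_iota /= => iL.
rewrite letterE // law_preimage; last exact: measurable_point.
by rewrite fineK // fin_num_measure //; exact: measurable_point.
Qed.

(** Complementing one event at a time, from the product rule for [occurs],
    proves the product rule for complements. *)
Let prob_none_all (J J' : seq nat) : uniq (J ++ J') ->
  P (\bigcap_(j in [set` J]) ~` occurs j `&` \bigcap_(j in [set` J']) occurs j) =
  ((1 - q) ^+ size J * q ^+ size J')%:E.
Proof.
have bigcap_cons (A : nat -> set Om) j s :
    \bigcap_(i in [set` j :: s]) A i = A j `&` \bigcap_(i in [set` s]) A i.
  apply/seteqP; split => w /= h.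
    by split=> [|i /= si]; apply: h; rewrite /= ?mem_head // inE si orbT.
  by move=> i /=; rewrite inE => /predU1P[->|si]; [have [] := h|have [_] := h; apply].
have measurable_cap (A : nat -> set Om) (s : seq nat) : (forall j, measurable (A j)) ->
    measurable (\bigcap_(j in [set` s]) A j).
  move=> mA; apply: fin_bigcap_measurable => //; exact: finite_seq.
elim: J J' => [|j J IH] J' uJ.
  by rewrite set_nil bigcap_set0 setTI expr0 mul1r prob_all.
have uJJ' : uniq (J ++ J') by case/andP: uJ.
have uJjJ' : uniq (J ++ j :: J').
  by rewrite -cat_rcons -cats1 -catA (perm_uniq (_ : perm_eq _ (j :: J ++ J'))) // perm_catCA.
rewrite bigcap_cons.
set A := \bigcap_(i in [set` J]) _; set B := \bigcap_(i in [set` J']) _.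
have mA : measurable A by apply: measurable_cap => i; exact: measurableC.
have mB : measurable B by exact: measurable_cap.
have split_occurs : P (A `&` B) =
    (P ((A `&` B) `\` occurs j) + P (A `&` B `&` occurs j))%E.
  exact: (measureDI P (measurableI _ _ mA mB) (measurable_occurs j)).
have AB : P (A `&` B) = ((1 - q) ^+ size J * q ^+ size J')%:E := IH _ uJJ'.
have ABj : P (A `&` B `&` occurs j) = ((1 - q) ^+ size J * q ^+ (size J').+1)%:E.
  rewrite -(IH _ uJjJ') bigcap_cons -/A -/B; congr (P _).
  by rewrite -setIA [B `&` _]setIC.
have -> : ~` occurs j `&` A `&` B = (A `&` B) `\` occurs j.
  by rewrite setDE setIC setIA setIAC [B `&` A]setIC.
move: split_occurs; rewrite AB ABj.
have : P ((A `&` B) `\` occurs j) \is a fin_num.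
  by apply: fin_num_measure; apply: measurableD => //; exact: measurableI.
case: (P _) => // r _; rewrite -EFinD => -[rE]; congr EFin.
by move: rE; rewrite !exprS => rE; lra.
Qed.

(** The event that no window shows the word has probability at most [(1 - q)
    ^+ K] for every [K]. *)
Lemma word_occurs_ae :
  {ae P, forall w, exists j, forall i, (i < L)%N -> X (pos j i) w = c i}.
Proof.
have mT : measurable (\bigcap_j ~` occurs j).
  by apply: bigcapT_measurable => j; exact: measurableC.
exists (\bigcap_j ~` occurs j); split => //; last first.
  by move=> w /= no j _ oc; apply: no; exists j.
have q0 : 0 < q.
  apply: prodr_gt0 => i _; rewrite fine_gt0 // c0 //=.
  by rewrite -ge0_fin_numE ?measure_ge0 // fin_num_measure //; exact: measurable_point.
have q1 : q <= 1.
  apply: prodr_ile1 => i _; rewrite fine_ge0 ?measure_ge0 //=.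
  rewrite -lee_fin fineK ?probability_le1 //; first exact: measurable_point.
  by rewrite fin_num_measure //; exact: measurable_point.
have bound K : (P (\bigcap_j ~` occurs j) <= ((1 - q) ^+ K)%:E)%E.
  have := @prob_none_all (iota 0 K) [::]; rewrite cats0 iota_uniq => /(_ isT).
  rewrite set_nil bigcap_set0 setIT size_iota expr0 mulr1 => <-.
  apply: le_measure; rewrite ?inE //.
    by apply: fin_bigcap_measurable => [|j _]; [exact: finite_seq|exact: measurableC].
  by move=> w h j _; exact: h.
have Pfin : P (\bigcap_j ~` occurs j) \is a fin_num by exact: fin_num_measure.
have : (0 <= P (\bigcap_j ~` occurs j))%E by exact: measure_ge0.
move: bound Pfin.
case: (P _) => // r bound _ pr0; congr EFin.
have r0 : 0 <= r by rewrite -lee_fin; exact: pr0.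
apply/eqP; rewrite eq_le r0 andbT.
have cv : (fun K => (1 - q) ^+ K) @ \oo --> (0 : R).
  by apply: cvg_expr; rewrite ger0_norm; lra.
rewrite -(cvg_lim _ cv) //; apply: limr_ge; first by apply/cvg_ex; exists 0.
by near=> K; have := bound K; rewrite lee_fin.
Unshelve. all: by end_near. Qed.

End Words.
End AlmostSure.

(** * The random operator *)

Section RandomTridiagonal.
Variable R : realType.

Lemma finite_points_bounded (F : set (R * R)) : finite_set F ->
  exists M : R, forall c, F c -> `|c.1| <= M /\ `|c.2| <= M.
Proof.
move=> /finite_seqP[s ->].
elim: s => [|c s [M HM]]; first by exists 0.
exists (`|M| + `|c.1| + `|c.2|) => e /=; rewrite inE.
have := normr_ge0 c.1; have := normr_ge0 c.2; have := ler_norm M; have := normr_ge0 M.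
by move=> ? ? ? ? /predU1P[->|/HM[]]; split; lra.
Qed.

Variables (mu : probability (R * R)%type R) (d : measure_display).
Variables (Om : measurableType d) (P : probability Om R).
Variable X : int -> {RV P >-> (R * R)%type}.
Hypothesis iidX : iid_with_law mu X.

Lemma symmetric_self_adjoint_ae (F : set (R * R)) : finite_set F -> mu F = 1%E ->
  (forall c, (0 < mu [set c])%E -> c.1 = c.2) ->
  {ae P, forall w, self_adjoint (tridiag_op (fun n => X n w))}.
Proof.
move=> finF muF sym; have [M HM] := finite_points_bounded finF.
apply: filterS (values_in_atoms iidX finF muF) => w Xw.
apply: (@tridiag_self_adjoint _ _ M) => n; have [Fn pn] := Xw n.
  by have [] := HM _ Fn.
exact: sym.
Qed.

Lemma zeros_unbounded_ae : (0 < mu [set (0, 0)%R])%E -> {ae P, forall w,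
  (forall k : int, exists2 n, k < n & X n w = (0, 0)) /\
  (forall k : int, exists2 n, n < k & X n w = (0, 0))}.
Proof.
move=> mu00; have up : {ae P, forall w, forall k : int, exists2 n, k < n & X n w = (0, 0)}.
  apply: ae_forall_countable => k.
  have := @word_occurs_ae _ _ _ _ _ _ iidX 1 (fun=> (0, 0)) (fun j _ => k + 1 + j%:Z).
  move=> /(_ _ (fun _ _ => mu00)) h.
  apply: filterS (h _) => [w [j /(_ 0%N isT) Xj]|].
    by exists (k + 1 + j%:Z) => //; lia.
  by move=> j i j' i'; rewrite !ltnS !leqn0 => /eqP -> /eqP -> jj; split => //; lia.
have low : {ae P, forall w, forall k : int, exists2 n, n < k & X n w = (0, 0)}.
  apply: ae_forall_countable => k.
  have := @word_occurs_ae _ _ _ _ _ _ iidX 1 (fun=> (0, 0)) (fun j _ => k - 1 - j%:Z).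
  move=> /(_ _ (fun _ _ => mu00)) h.
  apply: filterS (h _) => [w [j /(_ 0%N isT) Xj]|].
    by exists (k - 1 - j%:Z) => //; lia.
  by move=> j i j' i'; rewrite !ltnS !leqn0 => /eqP -> /eqP -> jj; split => //; lia.
exact: filterS2 up low.
Qed.

(** The word consists of [(0, 0)], then [2 m] times [(a, b)], then [(0, 0)];
    its windows tile the nonnegative integers. *)
Lemma constant_blocks_ae (a b : R) : (0 < mu [set (0, 0)%R])%E ->
  (0 < mu [set (a, b)])%E ->
  {ae P, forall w, forall m, exists k, constant_block (fun n => X n w) a b k m}.
Proof.
move=> mu00 muab; apply: ae_forall_countable => m.
pose c i : R * R := if (0 < i <= m.*2)%N then (a, b) else (0, 0).
have := @word_occurs_ae _ _ _ _ _ _ iidX m.*2.+2 c (fun j i => (j * m.*2.+2)%N%:Z + i%:Z).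
move=> h; apply: filterS (h _ _) => [w [j Xj]|j i j' i' iL iL' E|i _].
- exists (j * m.*2.+2)%N%:Z; split.
  + by have := Xj 0%N isT; rewrite addr0.
  + move=> i im; have := Xj i.+1; rewrite /c /= im => <-; last by lia.
    by congr (X _ w); lia.
  + have := Xj m.*2.+1; rewrite /c /= ltnn => <- //.
    by congr (X _ w); lia.
- have {}E : (j * m.*2.+2 + i = j' * m.*2.+2 + i')%N by lia.
  have := congr1 (fun n => n %/ m.*2.+2)%N E.
  rewrite !divnMDl // !divn_small // !addn0 => jj; split => //.
  by move: E; rewrite jj => /addnI.
- by rewrite /c; case: ifP.
Qed.

Lemma asymmetric_non_self_adjoint_ae (F : set (R * R)) (a b : R) :
  finite_set F -> mu F = 1%E -> (0 < mu [set (0, 0)%R])%E ->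
  a != b -> (0 < mu [set (a, b)])%E ->
  {ae P, forall w, non_self_adjoint (tridiag_op (fun n => X n w))}.
Proof.
move=> finF muF mu00 ab muab; have [M HM] := finite_points_bounded finF.
apply: filterS2 (values_in_atoms iidX finF muF) (constant_blocks_ae mu00 muab) => w Xw /(_ 1%N)[k].
move=> [_ /(_ 0%N isT) Xk _].
apply: (@tridiag_non_self_adjoint _ _ M (k + 1 + 0)) => [n|n|].
- by have [Fn _] := Xw n; have [] := HM _ Fn.
- by have [Fn _] := Xw n; have [] := HM _ Fn.
- by rewrite Xk.
Qed.

End RandomTridiagonal.

Theorem theorem8 (R : realType) (mu : probability (R * R)%type R)
    (F : set (R * R)) (finF : finite_set F) (muF : mu F = 1%E)
    (mu00 : (0 < mu [set (0, 0)%R])%E)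
    (mu_pos : forall x y : R, (x, y) <> (0, 0) ->
       (0 < mu [set (x, y)])%E -> 0 < x /\ 0 < y) :
  ((forall (d : measure_display) (Om : measurableType d)
      (P : probability Om R) (X : int -> {RV P >-> (R * R)%type}),
      iid_with_law mu X ->
      {ae P, forall w, self_adjoint (tridiag_op (fun n => X n w))})
   \/
   (forall (d : measure_display) (Om : measurableType d)
      (P : probability Om R) (X : int -> {RV P >-> (R * R)%type}),
      iid_with_law mu X ->
      {ae P, forall w, non_self_adjoint (tridiag_op (fun n => X n w))}))
  /\
  (forall (d : measure_display) (Om : measurableType d)
     (P : probability Om R) (X : int -> {RV P >-> (R * R)%type}),
     iid_with_law mu X ->
     {ae P, forall w, non_self_adjoint (tridiag_op (fun n => X n w))} ->
     {ae P, forall w,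
        let x := fun n => X n w in
        (exists N v, block_ends x N /\ block_eigenfamily x N v) /\
        (forall N v, block_ends x N -> block_eigenfamily x N v ->
           [/\ countable (block_spectrum x N),
               forall l, block_spectrum x N l ->
                 l2_eigenvalue (tridiag_op x) l,
               forall r l, block_eigenvalues x N r l ->
                 l2_eigenvector (tridiag_op x) l (v r l)
             & l2_dense (linear_span (block_eigenvectors x N v))])}
     /\
     {ae P, forall w,
        let x := fun n => X n w in
        forall N v, block_ends x N -> block_eigenfamily x N v ->
          ~ l2_basis (block_eigenvectors x N v)}).
Proof.
have [[[a b] [muab /= ab]]|sym] :=
    pselect (exists c : R * R, (0 < mu [set c])%E /\ c.1 != c.2); last first.
  have {}sym c : (0 < mu [set c])%E -> c.1 = c.2.
    by move=> muc; apply/eqP; apply: contrapT => h; apply: sym; exists c; split => //; exact/negP.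
  have sa d (Om : measurableType d) (P : probability Om R)
      (X : int -> {RV P >-> (R * R)%type}) : iid_with_law mu X ->
      {ae P, forall w, self_adjoint (tridiag_op (fun n => X n w))}.
    by move=> iidX; exact (symmetric_self_adjoint_ae iidX finF muF sym).
  split; first by left.
  move=> d Om P X iidX nsa; exfalso.
  have : {ae P, forall w : Om, False}.
    by apply: filterS2 (sa _ _ _ _ iidX) nsa => w saw [].
  rewrite /almost_everywhere => -[A [mA PA0 subA]].
  have AT : A = setT by apply/seteqP; split => // w _; apply: subA => /=.
  have := probability_setT P; rewrite -AT => PA1.
  have : (1 : \bar R)%E = 0%E by rewrite -PA1.
  by move=> /eqP; rewrite onee_eq0.
have ab0 : (a, b) <> (0, 0) by case=> a0 b0; rewrite a0 b0 eqxx in ab.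
have [a0 b0] := mu_pos a b ab0 muab.
split.
  by right=> d Om P X iidX; exact (asymmetric_non_self_adjoint_ae iidX finF muF mu00 ab muab).
move=> d Om P X iidX _.
have posX : {ae P, forall w, forall n, X n w <> (0, 0) -> 0 < (X n w).1 /\ 0 < (X n w).2}.
  apply: filterS (values_in_atoms iidX finF muF) => w Xw n Xn.
  by have [_] := Xw n; move: Xn; case: (X n w) => u v; exact: mu_pos.
split.
  apply: filterS2 posX (zeros_unbounded_ae iidX mu00) => w pos [up low].
  pose x n := X n w; rewrite -/x.
  split.
    have [N [N1 N2 N3 N4]] := @unbounded_enumeration [set n | x n = (0, 0)] up low.
    have xN : block_ends x N by [].
    by have [v xv] := block_eigenfamily_exists x N; exists N, v.
  move=> N v xN xv; split.
  - exact: countable_block_spectrum.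
  - move=> l [r _ /block_eigenvaluesP[u u0 uE]].
    by exists (block_extend u); exact: block_extend_eigenvector.
  - by move=> r l /xv[u [u0 uE ->]]; exact: block_extend_eigenvector.
  - exact: block_eigenvectors_dense.
apply: filterS (constant_blocks_ae iidX mu00 muab) => w blocks N v xN xv.
exact: constant_blocks_not_basis xN xv a0 b0 ab blocks.
Qed.
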